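(* Let $Q,B$ be $n\times n$ real matrices satisfying the standing assumptions, with local homogeneous dimension $D$ and volume function $V$. Suppose that one of the following holds: (i) $\sigma(B)\not\subset i\mathbb R$; (ii) $\sigma(B)\subset i\mathbb R$ and $\operatorname{Rank}(Q)=n$; (iii) $B$ is nilpotent and equal to $$\overline B=\begin{pmatrix}0&0&\cdots&0&0\\ B_1&0&\cdots&0&0\\ 0&B_2&\cdots&0&0\\ \vdots&\vdots&\ddots&\vdots&\vdots\\ 0&0&\cdots&B_\nu&0\end{pmatrix},$$ i.e. in the canonical form of $B$ all blocks on or above the diagonal are zero. Then there exists $\gamma>0$ such that $$V(t)\ge\gamma\,t^{D}e^{t\operatorname{tr}B}\qquad\text{for every }t>0.$$
   Context: Standing assumptions. $n\ge2$; $Q,B$ are constant real $n\times n$ matrices, $Q=Q^\star\ge0$ ($^\star$ is transpose). $\operatorname{Ker}Q$ contains no nontrivial invariant subspace of $B^\star$; equivalently the Gramian $Q(t)=\int_0^te^{sB}Qe^{sB^\star}ds$ is positive definite for every $t>0$. Moreover $Q,B$ are in canonical form: $Q=\begin{pmatrix}Q_0&0\\0&0\end{pmatrix}$ with $Q_0=Q_0^\star>0$ of size $p_0\times p_0$, and with respect to the block partition $n=p_0+p_1+\dots+p_\nu$, $p_0\ge p_1\ge\dots\ge p_\nu\ge1$, the matrix $B$ has subdiagonal blocks $B_1,\dots,B_\nu$, where $B_j$ is $p_j\times p_{j-1}$ of rank $p_j$ (in block position row $j$, column $j-1$, blocks numbered from $0$), all blocks strictly below the subdiagonal are zero, and all blocks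 on or above the diagonal are arbitrary. If $Q$ is invertible then $p_0=n$ and there are no other blocks (and then $\overline B=0$). Local homogeneous dimension: $D=p_0+3p_1+5p_2+\dots+(2\nu+1)p_\nu$ (so $D=n$ when $Q$ is invertible). Volume function: $V(t)=\det Q(t)$, $t>0$. $\sigma(B)\subset\mathbb C$ is the spectrum of $B$ and $i\mathbb R$ is the imaginary axis. *)

(* Defs.v *)
From HB Require Import structures.
From mathcomp Require Import all_boot all_order all_algebra.
From mathcomp Require Import all_classical all_reals all_analysis.
From mathcomp Require Import complex.

Set Implicit Arguments.
Unset Strict Implicit.
Unset Printing Implicit Defensive.

Import Order.TTheory GRing.Theory Num.Theory.
Import numFieldNormedType.Exports.

Local Open Scope classical_set_scope.
Local Open Scope ring_scope.

Section MatrixNotions.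
Context {R : realType} {n : nat}.
Implicit Types A B Q : 'M[R]_n.

Definition possemidefmx A : Prop :=
  forall x : 'cV[R]_n, 0 <= (x^T *m A *m x) 0 0.

Definition posdefmx A : Prop :=
  forall x : 'cV[R]_n, x != 0 -> 0 < (x^T *m A *m x) 0 0.

Definition nilpotentmx A : Prop := exists k : nat, A ^+ k = 0.

(* A subspace of column vectors is encoded by a matrix W whose rows span the
   transposes of its elements; hence Q x = 0 on the subspace reads
   W *m Q^T = 0, and its invariance under A reads stablemx W A^T. *)
Definition no_invariant_subspace_in_ker Q A : Prop :=
  forall W : 'M[R]_n, W *m Q^T = 0 -> stablemx W A^T -> W = 0.

Definition expmx A : 'M[R]_n :=
  limn (series (fun k : nat => (k`!%:R)^-1 *: A ^+ k)).

Definition gramian Q B (t : R) : 'M[R]_n :=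
  \matrix_(i, j) \int[lebesgue_measure]_(s in `[0, t])
    (expmx (s *: B) *m Q *m expmx (s *: B^T)) i j.

Definition volume Q B (t : R) : R := \det (gramian Q B t).

Definition spectrum A : set R[i] :=
  [set z | eigenvalue (map_mx (real_complex R) A) z].

End MatrixNotions.

Definition imaginary_axis {R : realType} : set R[i] :=
  [set z | complex.Re z = 0].

Section CanonicalForm.
Context {R : realType} {nu : nat} {p : 'I_nu.+1 -> nat}.
Implicit Types Q B : 'M[R]_(\sum_i p i).

Record canonical_form Q B : Prop := CanonicalForm {
  canon_size_gt0 : forall i, (1 <= p i)%N ;
  canon_size_noninc : forall i j : 'I_nu.+1, (i <= j)%N -> (p j <= p i)%N ;
  canon_Q0_sym : (submxblock Q ord0 ord0)^T = submxblock Q ord0 ord0 ;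
  canon_Q0_posdef : posdefmx (submxblock Q ord0 ord0) ;
  canon_Q_eq0 : forall i j : 'I_nu.+1,
    (i, j) != (ord0, ord0) -> submxblock Q i j = 0 ;
  canon_B_subdiag_rank : forall i j : 'I_nu.+1,
    i = j.+1 :> nat -> \rank (submxblock B i j) = p i ;
  canon_B_below_eq0 : forall i j : 'I_nu.+1,
    (j.+1 < i)%N -> submxblock B i j = 0
}.

Record standing_assumptions Q B : Prop := StandingAssumptions {
  standing_size_ge2 : (2 <= \sum_i p i)%N ;
  standing_Q_sym : Q^T = Q ;
  standing_Q_psd : possemidefmx Q ;
  standing_ker : no_invariant_subspace_in_ker Q B^T ;
  standing_canonical : canonical_form Q B
}.

Definition subdiagonal_part B : 'M[R]_(\sum_i p i) :=
  \mxblock_(i < nu.+1, j < nu.+1)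
    (if nat_of_ord i == j.+1 then submxblock B i j else 0).

End CanonicalForm.

Definition local_homogeneous_dim (nu : nat) (p : 'I_nu.+1 -> nat) : nat :=
  (\sum_(j < nu.+1) (2 * j + 1) * p j)%N.

(* Main.v *)
(* The Gramian satisfies V_B(t) = e^(2 t tr B) V_(-B)(t) (time reversal), and it
   is nondecreasing in t as a quadratic form.

   Small times: with D_t = diag(t^j) on block j one has
   V_B(t) = t^D V_(B_t)(1), where B_t = t D_t^-1 B D_t is polynomial in t and
   tends to the subdiagonal part of B at t = 0.  Every B_t, t = 0 included, is
   in canonical form, so the continuous function V_(B_t)(1) has a positive
   minimum on [0, 1].  In case (iii) B_t = B and V_B(t) = t^D V_B(1).

   Large times, case (i): if tr B < 0, monotonicity of V suffices.  If tr B = 0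
   and B has an eigenvalue of real part a > 0, the quadratic form of the Gramian
   grows like e^(2 a t) along an eigenvector while it stays bounded below in
   all directions, so V grows exponentially.  Time reversal reduces the other
   cases to these two.

   Case (ii): when Q > 0, normalise the Gramian at time t to the identity by a
   congruence L.  The arithmetic-geometric inequality bounds the trace of
   L e^(sB) Q e^(sB^T) L^T from below by its determinant, and integrating over
   s in [0, t] gives V(t) >= det Q t^n e^(t tr B). *)
Require Import Defs.
From mathcomp Require Import all_boot all_order all_algebra.
From mathcomp Require Import all_classical all_reals all_analysis.
From mathcomp Require Import fingroup perm complex ring lra.

Set Implicit Arguments.
Unset Strict Implicit.
Unset Printing Implicit Defensive.

Import Order.TTheory GRing.Theory Num.Theory.
Import numFieldNormedType.Exports.

Local Open Scope classical_set_scope.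
Local Open Scope ring_scope.

(** * The exponential series of a matrix, entry by entry *)

Section MatrixExponential.
Context {R : realType}.

Lemma cvg_sumr (I : finType) (T : Type) (F : set_system T) {FF : Filter F}
    (f : I -> T -> R) (l : I -> R) :
  (forall i, f i @ F --> l i) -> (fun x => \sum_i f i x) @ F --> \sum_i l i.
Proof.
by move=> fl; apply: cvg_big => [|i _]; [exact: add_continuous|exact: fl].
Qed.

Lemma cvg_mx_entry m n (u : nat -> 'M[R]_(m, n)) (M : 'M[R]_(m, n)) :
  (forall i j, (fun k => u k i j) @ \oo --> M i j) -> u @ \oo --> M.
Proof.
move=> uM; apply/cvgrPdist_lt => e e0.
have : \forall k \near \oo, forall i j, `|M i j - u k i j| < e.
  apply: filter_forall => i; apply: filter_forall => j.
  by have /cvgrPdist_lt/(_ _ e0) := uM i j.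
apply: filterS => k ke; rewrite /Num.norm /= mx_normrE; apply/bigmax_ltP.
by split=> // -[i j] _; rewrite !mxE; exact: ke.
Qed.

Lemma expmx_entry_bound n (A : 'M[R]_n) (a : R) k i j :
  (forall i j, `|A i j| <= a) -> `|(A ^+ k) i j| <= (n%:R * a) ^+ k.
Proof.
move=> Aa; elim: k i j => [|k IH] i j.
  by rewrite !expr0 mxE; case: (i == j); rewrite ?normr1 ?normr0.
rewrite !exprS -mulmxE mxE (le_trans (ler_norm_sum _ _ _)) //.
have : \sum_(l < n) `|A i l * (A ^+ k) l j| <=
       \sum_(l < n) a * (n%:R * a) ^+ k.
  by apply: ler_sum => l _; rewrite normrM ler_pM.
by rewrite sumr_const card_ord -[_ *+ n]mulr_natl mulrA.
Qed.

Lemma exp_scalemx n (A : 'M[R]_n) s k : (s *: A) ^+ k = s ^+ k *: A ^+ k.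
Proof.
elim: k => [|k IH]; first by rewrite !expr0 scale1r.
by rewrite exprS IH -mulmxE -scalemxAl -scalemxAr scalerA mulmxE -!exprS.
Qed.

(** Taylor coefficients of one entry of [expmx (s *: A)] as a function of [s], which gives access to
    the scalar theory of power series. *)
Definition expcoef n (A : 'M[R]_n) i j : R^nat :=
  fun k => k`!%:R^-1 * (A ^+ k) i j.

Lemma expcoef_scale n (A : 'M[R]_n) i j s k :
  expcoef (s *: A) i j k = expcoef A i j k * s ^+ k.
Proof. by rewrite /expcoef exp_scalemx mxE mulrCA mulrC. Qed.

Lemma pseries_diffs_expcoef n (A : 'M[R]_n) i j :
  pseries_diffs (expcoef A i j) = \sum_l A i l *: expcoef A l j.
Proof.
apply/funext => k; rewrite /pseries_diffs /expcoef fct_sumE.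
rewrite factS natrM invfM mulrA mulVKf // exprS -mulmxE mxE mulr_sumr.
by apply: eq_bigr => l _; rewrite mulrCA.
Qed.

Lemma entries_bounded m n (A : 'M[R]_(m, n)) :
  exists2 a : R, 0 <= a & forall i j, `|A i j| <= a.
Proof.
exists (\sum_i \sum_j `|A i j|).
  by apply: sumr_ge0 => i _; apply: sumr_ge0 => j _.
move=> i j; rewrite (bigD1 i) //= (bigD1 j) //= -addrA lerDl addr_ge0 //.
  exact: sumr_ge0.
by apply: sumr_ge0 => i' _; apply: sumr_ge0.
Qed.

Lemma is_cvg_series_expcoef n (A : 'M[R]_n) i j :
  cvgn (series (expcoef A i j)).
Proof.
have [a a0 Aa] := entries_bounded A.
apply: normed_cvg.
apply: (@series_le_cvg _ _ (exp_coeff (n%:R * a))) => [k|k|k|].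
- exact: normr_ge0.
- by rewrite exp_coeff_ge0 // mulr_ge0.
- rewrite /expcoef /exp_coeff /= normrM normfV normr_nat mulrC.
  rewrite ler_wpM2r ?invr_ge0 //.
  exact: expmx_entry_bound.
- exact: is_cvg_series_exp_coeff.
Qed.

Lemma expmxE n (A : 'M[R]_n) i j : expmx A i j = limn (series (expcoef A i j)).
Proof.
suff : series (fun k => k`!%:R^-1 *: A ^+ k) @ \oo -->
    (\matrix_(i, j) limn (series (expcoef A i j)) : 'M[R]_n).
  by move=> /cvg_lim; rewrite /expmx => -> //; rewrite mxE.
apply: cvg_mx_entry => {}i {}j; rewrite mxE.
rewrite (_ : (fun k => _) = series (expcoef A i j)).
  exact: is_cvg_series_expcoef.
apply/funext => k; rewrite /series /= summxE.
by apply: eq_bigr => l _; rewrite mxE.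
Qed.

Lemma expmx_cvg n (A : 'M[R]_n) i j :
  series (expcoef A i j) @ \oo --> expmx A i j.
Proof. by rewrite expmxE; exact: is_cvg_series_expcoef. Qed.

Lemma pseries_expcoef n (A : 'M[R]_n) i j s :
  pseries (expcoef A i j) s = series (expcoef (s *: A) i j).
Proof.
by rewrite /pseries; congr series; apply/funext => k; rewrite expcoef_scale.
Qed.

Lemma cvg_pseries_lincomb (I : finType) (c : I -> R) (f : I -> R^nat) s
    (l : I -> R) :
  (forall i, pseries (f i) s @ \oo --> l i) ->
  pseries (\sum_i (c i *: f i)) s @ \oo --> \sum_i c i * l i.
Proof.
move=> fl.
rewrite (_ : pseries _ s = (fun n => \sum_i c i * pseries (f i) s n)).
  by apply: cvg_sumr => i; apply: cvgMl_tmp; exact: fl.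
apply/funext => n; rewrite /pseries /series /=.
under [RHS]eq_bigr do rewrite mulr_sumr.
rewrite exchange_big /=; apply: eq_bigr => k _.
by rewrite fct_sumE mulr_suml; apply: eq_bigr => i _; rewrite mulrA.
Qed.

Lemma is_derive_expmx n (A : 'M[R]_n) (s : R) i j :
  is_derive s 1 (fun u => expmx (u *: A) i j) ((A *m expmx (s *: A)) i j).
Proof.
have cv l u : pseries (expcoef A l j) u @ \oo --> expmx (u *: A) l j.
  by rewrite pseries_expcoef; exact: expmx_cvg.
have cvd l u : pseries (pseries_diffs (expcoef A l j)) u @ \oo -->
               (A *m expmx (u *: A)) l j.
  rewrite pseries_diffs_expcoef mxE; apply: cvg_pseries_lincomb => l'.
  exact: cv.
have cvdd u : cvgn (pseries (pseries_diffs (pseries_diffs (expcoef A i j))) u).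
  rewrite (_ : pseries_diffs (pseries_diffs _) =
    \sum_l A i l *: pseries_diffs (expcoef A l j)).
    by apply/cvg_ex; eexists; apply: cvg_pseries_lincomb => l; exact: cvd.
  rewrite pseries_diffs_expcoef; apply/funext => k.
  rewrite /pseries_diffs !fct_sumE mulr_sumr.
  by apply: eq_bigr => l _; rewrite mulrCA.
(* Termwise differentiation at [s] needs the series and its first two formal derivatives to converge
   at a point of larger modulus; [|s| + 1] serves. *)
have := @pseries_snd_diffs _ (expcoef A i j) (`|s| + 1) s
   (cvgP _ (cv i _)) (cvgP _ (cvd i _)) (cvdd _).
rewrite (cvg_lim _ (cvd i s)) //.
rewrite (_ : (fun x => limn _) = fun u => expmx (u *: A) i j).
  by apply; rewrite [ltRHS]ger0_norm ?addr_ge0 // ltrDl.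
by apply/funext => u; apply/cvg_lim => //; exact: cv.
Qed.

Lemma expmx0 n : expmx (0 : 'M[R]_n) = 1%:M.
Proof.
apply/matrixP => i j; rewrite expmxE; apply: lim_near_cst => //.
(* Partial sums equal the identity as soon as they contain the term of index 0; the empty sum is
   excluded. *)
near=> m; rewrite -[m]prednK; last by near: m; exists 1%N.
rewrite /series /= big_nat_recl //= big1_seq ?addr0.
  by rewrite /expcoef expr0 invr1 mul1r.
by move=> k _; rewrite /expcoef expr0n /= mxE mulr0.
Unshelve. all: by end_near. Qed.

(** The relation passes to all powers, then to the limit. A rectangular [X] is allowed: this covers
    commutation with [A], the extraction of a block row, and conjugation by dilations. *)
Lemma expmx_intertwine m n (X : 'M[R]_(m, n)) (A : 'M[R]_n) (A' : 'M[R]_m) :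
  X *m A = A' *m X -> X *m expmx A = expmx A' *m X.
Proof.
move=> XA; have XAk k : X *m A ^+ k = A' ^+ k *m X.
  elim: k => [|k IH]; first by rewrite !expr0 mulmx1 mul1mx.
  by rewrite exprS -mulmxE mulmxA XA -mulmxA IH mulmxA mulmxE -exprS.
apply/matrixP => i j; rewrite !mxE.
have cl : series (fun k => k`!%:R^-1 * (X *m A ^+ k) i j) @ \oo -->
          \sum_l X i l * expmx A l j.
  rewrite (_ : series _ = (fun k => \sum_l X i l * series (expcoef A l j) k)).
    by apply: cvg_sumr => l; apply: cvgMl_tmp; exact: expmx_cvg.
  apply/funext => k; rewrite /series /=; under [RHS]eq_bigr do rewrite mulr_sumr.
  rewrite exchange_big /=; apply: eq_bigr => k' _; rewrite mxE mulr_sumr.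
  by apply: eq_bigr => l _; rewrite /expcoef mulrCA.
have cr : series (fun k => k`!%:R^-1 * (A' ^+ k *m X) i j) @ \oo -->
          \sum_l expmx A' i l * X l j.
  rewrite (_ : series _ = (fun k => \sum_l series (expcoef A' i l) k * X l j)).
    by apply: cvg_sumr => l; apply: cvgMr_tmp; exact: expmx_cvg.
  apply/funext => k; rewrite /series /=; under [RHS]eq_bigr do rewrite mulr_suml.
  rewrite exchange_big /=; apply: eq_bigr => k' _; rewrite mxE mulr_sumr.
  by apply: eq_bigr => l _; rewrite /expcoef mulrA.
have e : (fun k => k`!%:R^-1 * (X *m A ^+ k) i j) =
         (fun k => k`!%:R^-1 * (A' ^+ k *m X) i j).
  by apply/funext => k; rewrite XAk.
rewrite e in cl.
exact: (cvg_unique _ cl cr).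
Qed.

Lemma expmx_tr n (A : 'M[R]_n) : (expmx A)^T = expmx A^T.
Proof.
apply/matrixP => i j; rewrite mxE !expmxE; congr (limn (series _)).
apply/funext => k; rewrite /expcoef; congr (_ * _).
suff -> : A^T ^+ k = (A ^+ k)^T by rewrite mxE.
elim: k => [|k IH]; first by rewrite !expr0 trmx1.
by rewrite exprS exprSr -!mulmxE trmx_mul IH.
Qed.

(** Writing A^(k+1) - A'^(k+1) = A (A^k - A'^k) + (A - A') A'^k bounds the difference of k-th powers
    by k (n a)^(k-1) n d. Division by k! turns this into a shifted exponential series. *)
Lemma expmx_entry_lipschitz n (A A' : 'M[R]_n) (a d : R) i j :
  (forall i j, `|A i j| <= a) -> (forall i j, `|A' i j| <= a) ->
  (forall i j, `|A i j - A' i j| <= d) ->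
  `|expmx A i j - expmx A' i j| <= n%:R * d * expR (n%:R * a).
Proof.
move=> Aa A'a Ad.
have a0 : 0 <= n%:R * a by rewrite mulr_ge0 // (le_trans (normr_ge0 _) (Aa i j)).
have d0 : 0 <= n%:R * d by rewrite mulr_ge0 // (le_trans (normr_ge0 _) (Ad i j)).
have pow k i' j' : `|(A ^+ k) i' j' - (A' ^+ k) i' j'| <=
    k%:R * (n%:R * a) ^+ k.-1 * (n%:R * d).
  elim: k i' j' => [|k IH] i' j'; first by rewrite !expr0 subrr normr0 !mul0r.
  have -> : (A ^+ k.+1) i' j' - (A' ^+ k.+1) i' j' =
      \sum_l (A i' l * ((A ^+ k) l j' - (A' ^+ k) l j') +
              (A i' l - A' i' l) * (A' ^+ k) l j').
    rewrite !exprS -!mulmxE !mxE -sumrB; apply: eq_bigr => l _; ring.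
  rewrite (le_trans (ler_norm_sum _ _ _)) //.
  have : forall l, `|A i' l * ((A ^+ k) l j' - (A' ^+ k) l j') +
              (A i' l - A' i' l) * (A' ^+ k) l j'| <=
         a * (k%:R * (n%:R * a) ^+ k.-1 * (n%:R * d)) + d * (n%:R * a) ^+ k.
    move=> l; rewrite (le_trans (ler_normD _ _)) // lerD // normrM ler_pM //.
    exact: expmx_entry_bound.
  move=> le; rewrite (le_trans (ler_sum _ (fun l _ => le l))) //.
  rewrite sumr_const card_ord -[_ *+ n]mulr_natl /= le_eqVlt; apply/orP; left.
  apply/eqP; case: k {IH le} => [|k] /=; first by ring.
  by rewrite -[in RHS](natr1 k.+1) exprS; ring.
have part m : `|series (expcoef A i j) m - series (expcoef A' i j) m| <=
    n%:R * d * expR (n%:R * a).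
  rewrite /series /= -sumrB (le_trans (ler_norm_sum _ _ _)) //.
  apply: (@le_trans _ _ (n%:R * d * series (exp_coeff (n%:R * a)) m)); last first.
    rewrite ler_wpM2l // /expR; apply: nondecreasing_cvgn_le.
      apply/nondecreasing_seqP => k; rewrite /series /= big_nat_recr //= lerDl.
      exact: exp_coeff_ge0.
    exact: is_cvg_series_exp_coeff.
  (* The terms of index 0 cancel, so the sum starts at index 1, where k / k! = 1 / (k-1)!. *)
  case: m => [|m]; first by rewrite /series /= !big_geq ?mulr0.
  rewrite big_nat_recl // /expcoef !expr0 subrr normr0 add0r /series /=.
  apply: (@le_trans _ _ (n%:R * d * \sum_(0 <= k < m) exp_coeff (n%:R * a) k)).
    rewrite mulr_sumr; apply: ler_sum => k _; rewrite -mulrBr normrM.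
    rewrite ger0_norm ?invr_ge0 // ler_pdivrMl ?ltr0n ?fact_gt0 //.
    rewrite (le_trans (pow _ _ _)) //= /exp_coeff /= factS natrM.
    rewrite le_eqVlt; apply/orP; left; apply/eqP; field.
    by rewrite pnatr_eq0 -lt0n fact_gt0.
  rewrite ler_wpM2l // [leRHS]big_nat_recr //= lerDl; exact: exp_coeff_ge0.
have cN := cvg_norm (cvgB (@expmx_cvg _ A i j) (@expmx_cvg _ A' i j)).
by apply: (cvgr_to_le (cN _ _)); apply: nearW => m; exact: part.
Qed.

End MatrixExponential.

(** * Entrywise derivatives, the group law and the determinant of the exponential *)

Section MatrixCalculus.
Context {R : realType}.

Definition is_mxderive m n (F F' : R -> 'M[R]_(m, n)) :=
  forall (s : R) i j, is_derive s 1 (fun u => F u i j) (F' s i j).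

Lemma is_derive_bigsum (I : Type) (r : seq I) (f : I -> R -> R) (df : I -> R) (x : R) :
  (forall i, is_derive x 1 (f i) (df i)) ->
  is_derive x 1 (fun u => \sum_(i <- r) f i u) (\sum_(i <- r) df i).
Proof.
move=> fd; elim: r => [|i r IH].
  rewrite big_nil (_ : (fun _ => _) = cst 0); first exact: is_derive_cst.
  by apply/funext => u; rewrite big_nil.
rewrite big_cons (_ : (fun _ => _) = f i + (fun u => \sum_(i <- r) f i u)).
  exact: is_deriveD.
by apply/funext => u; rewrite big_cons.
Qed.

Lemma is_deriveM1 (f g : R -> R) (df dg x : R) :
  is_derive x 1 f df -> is_derive x 1 g dg ->
  is_derive x 1 (fun u => f u * g u) (df * g x + f x * dg).
Proof.
move=> fd gd; have := is_deriveM fd gd.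
by rewrite addrC [g x *: df]mulrC; exact.
Qed.

(** Leibniz rule by induction on the list; [uniq r] ensures that the condition [j != i] drops
    exactly one factor. *)
Lemma is_derive_bigprod (I : eqType) (r : seq I) (f : I -> R -> R) (df : I -> R) (x : R) :
  uniq r -> (forall i, is_derive x 1 (f i) (df i)) ->
  is_derive x 1 (fun u => \prod_(i <- r) f i u)
    (\sum_(i <- r) df i * \prod_(j <- r | j != i) f j x).
Proof.
move=> ur fd; elim: r ur => [_|i r IH /= /andP[ir ur]].
  rewrite big_nil (_ : (fun _ => _) = cst 1); first exact: is_derive_cst.
  by apply/funext => u; rewrite big_nil.
rewrite (_ : (fun _ => _) = fun u => f i u * \prod_(j <- r) f j u); last first.
  by apply/funext => u; rewrite big_cons.
have := is_deriveM1 (fd i) (IH ur).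
move/is_derive_eq; apply; rewrite big_cons big_cons eqxx /=; congr (_ * _ + _).
  rewrite big_seq [RHS]big_seq_cond; apply: eq_bigl => j.
  by case jr : (j \in r) => //=; apply/esym; apply: contraNneq ir => <-.
rewrite mulr_sumr; apply: eq_big_seq => j jr.
rewrite big_cons ifT; first by rewrite mulrCA.
by apply: contraNneq ir => ->.
Qed.

Lemma mxderive_cst m n (C : 'M[R]_(m, n)) : is_mxderive (fun=> C) (fun=> 0).
Proof. by move=> s i j; rewrite mxE; exact: is_derive_cst. Qed.

Lemma mxderiveD m n (F F' G G' : R -> 'M[R]_(m, n)) :
  is_mxderive F F' -> is_mxderive G G' ->
  is_mxderive (fun u => F u + G u) (fun u => F' u + G' u).
Proof.
move=> FF' GG' s i j; rewrite mxE.
rewrite (_ : (fun _ => _) = (fun u => F u i j) + (fun u => G u i j)).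
  exact: is_deriveD.
by apply/funext => u; rewrite mxE.
Qed.

Lemma mxderiveM m n p (F F' : R -> 'M[R]_(m, n)) (G G' : R -> 'M[R]_(n, p)) :
  is_mxderive F F' -> is_mxderive G G' ->
  is_mxderive (fun u => F u *m G u) (fun u => F' u *m G u + F u *m G' u).
Proof.
move=> FF' GG' s i j; rewrite !mxE -big_split.
rewrite (_ : (fun _ => _) = fun u => \sum_l F u i l * G u l j).
  by apply: is_derive_bigsum => l; exact: is_deriveM1.
by apply/funext => u; rewrite mxE.
Qed.

Lemma mxderive_eq m n (F F' G' : R -> 'M[R]_(m, n)) :
  is_mxderive F F' -> F' =1 G' -> is_mxderive F G'.
Proof. by move=> FF' e s i j; rewrite -e. Qed.

Lemma mxderiveMl m n p (C : 'M[R]_(m, n)) (G G' : R -> 'M[R]_(n, p)) :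
  is_mxderive G G' -> is_mxderive (fun u => C *m G u) (fun u => C *m G' u).
Proof.
move=> GG'; apply: mxderive_eq (mxderiveM (mxderive_cst C) GG') _ => u.
by rewrite mul0mx add0r.
Qed.

Lemma mxderiveMr m n p (C : 'M[R]_(n, p)) (G G' : R -> 'M[R]_(m, n)) :
  is_mxderive G G' -> is_mxderive (fun u => G u *m C) (fun u => G' u *m C).
Proof.
move=> GG'; apply: mxderive_eq (mxderiveM GG' (mxderive_cst C)) _ => u.
by rewrite mulmx0 addr0.
Qed.

Lemma mxderiveZ m n (c : R) (G G' : R -> 'M[R]_(m, n)) :
  is_mxderive G G' -> is_mxderive (fun u => c *: G u) (fun u => c *: G' u).
Proof.
move=> /(mxderiveMl c%:M) GG' s i j; rewrite -mul_scalar_mx.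
by under eq_fun do rewrite -mul_scalar_mx; exact: GG'.
Qed.

Lemma mxderive_tr m n (F F' : R -> 'M[R]_(m, n)) :
  is_mxderive F F' -> is_mxderive (fun u => (F u)^T) (fun u => (F' u)^T).
Proof.
by move=> FF' s i j; rewrite mxE; under eq_fun do rewrite mxE; exact: FF'.
Qed.

Lemma is_derive_affine (c d s : R) : is_derive s 1 (fun u => c * u + d) c.
Proof.
have := is_deriveD (is_deriveZ c (is_derive_id s 1)) (is_derive_cst d s 1).
by move/is_derive_eq; apply; rewrite addr0 [_ *: _]mulr1.
Qed.

Lemma mxderive_affine m n (F F' : R -> 'M[R]_(m, n)) (c d : R) :
  is_mxderive F F' ->
  is_mxderive (fun u => F (c * u + d)) (fun u => c *: F' (c * u + d)).
Proof.
move=> FF' s i j; rewrite mxE mulrC.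
have cd := is_derive_affine c d s.
exact: (@is_derive1_comp _ (fun v => F v i j) (fun u => c * u + d)).
Qed.

Lemma mxderive0_cst m n (F : R -> 'M[R]_(m, n)) :
  is_mxderive F (fun=> 0) -> forall s t, F s = F t.
Proof.
move=> F0 s t; apply/matrixP => i j.
apply: (@is_derive_0_is_cst _ (fun u => F u i j)) => x.
by have := F0 x i j; rewrite mxE.
Qed.

(** The difference has zero derivative. Symmetry, time reversal and rescaling of the Gramian are all
    proved by this comparison. *)
Lemma mxderive_unique m n (F G F' : R -> 'M[R]_(m, n)) :
  is_mxderive F F' -> is_mxderive G F' -> F 0 = G 0 -> F =1 G.
Proof.
move=> FF' GF' FG t.
have d0 : is_mxderive (fun u => F u + (-1) *: G u) (fun=> 0).
  apply: mxderive_eq (mxderiveD FF' (mxderiveZ (-1) GF')) _ => u.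
  by rewrite scaleN1r subrr.
have := mxderive0_cst d0 t 0; rewrite FG !scaleN1r subrr => /eqP.
by rewrite subr_eq0 => /eqP.
Qed.

Lemma mxderive_expmx n (A : 'M[R]_n) :
  is_mxderive (fun u => expmx (u *: A)) (fun u => A *m expmx (u *: A)).
Proof. by move=> s i j; exact: is_derive_expmx. Qed.

Lemma expmxZ_comm n (A : 'M[R]_n) s :
  A *m expmx (s *: A) = expmx (s *: A) *m A.
Proof. by apply: expmx_intertwine; rewrite -scalemxAr -scalemxAl. Qed.

(** The product is constant in [s], since its derivative vanishes, and it is compared with [s = 0].
    Both the inverse and the group law follow. *)
Lemma expmx_backward n (A : 'M[R]_n) s t :
  expmx ((- s) *: A) *m expmx ((s + t) *: A) = expmx (t *: A).
Proof.
pose G u := expmx ((-1 * u + 0) *: A) *m expmx ((1 * u + t) *: A).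
have G0 : is_mxderive G (fun=> 0).
  have := mxderiveM (mxderive_affine (-1) 0 (mxderive_expmx A))
                    (mxderive_affine 1 t (mxderive_expmx A)).
  move=> h; apply: mxderive_eq h _ => u.
  by rewrite scale1r scaleN1r mulNmx expmxZ_comm mulmxA addNr.
have := mxderive0_cst G0 s 0; rewrite /G !mulN1r !mul1r !addr0 add0r => ->.
by rewrite oppr0 scale0r expmx0 mul1mx.
Qed.

Lemma expmxNK n (A : 'M[R]_n) s : expmx ((- s) *: A) *m expmx (s *: A) = 1%:M.
Proof. by have := expmx_backward A s 0; rewrite addr0 scale0r expmx0. Qed.

Lemma expmxKN n (A : 'M[R]_n) s : expmx (s *: A) *m expmx ((- s) *: A) = 1%:M.
Proof. by have := expmxNK A (- s); rewrite opprK. Qed.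

Lemma expmxZD n (A : 'M[R]_n) s t :
  expmx ((s + t) *: A) = expmx (s *: A) *m expmx (t *: A).
Proof. by rewrite -(expmx_backward A s t) mulmxA expmxKN mul1mx. Qed.

(** Jacobi's formula at the identity: in the expansion over permutations only the identity
    contributes, with the sum of the diagonal derivatives. *)
Lemma is_derive_det1 n (F F' : R -> 'M[R]_n) :
  is_mxderive F F' -> F 0 = 1%:M ->
  is_derive (0 : R) 1 (fun u => \det (F u)) (\tr (F' 0)).
Proof.
move=> FF' F0.
rewrite (_ : (fun _ => _) =
  fun u => \sum_(s : 'S_n) (-1) ^+ s * \prod_i F u i (s i)); last by [].
have := @is_derive_bigsum _ (index_enum 'S_n)
  (fun s u => (-1) ^+ s * \prod_i F u i (s i))
  (fun s => (-1) ^+ s *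
     \sum_i F' 0 i (s i) * \prod_(j | j != i) F 0 j (s j)) 0.
have h (s : 'S_n) : is_derive (0 : R) 1 (fun u => (-1) ^+ s * \prod_i F u i (s i))
   ((-1) ^+ s * \sum_i F' 0 i (s i) * \prod_(j | j != i) F 0 j (s j)).
  have := is_deriveM1 (is_derive_cst ((-1) ^+ s : R) (0 : R) 1)
    (is_derive_bigprod (index_enum_uniq 'I_n) (fun i => FF' 0 i (s i))).
  by rewrite mul0r add0r; exact.
move=> /(_ h); move=> /is_derive_eq; apply.
rewrite (bigD1 1%g) //= odd_perm1 expr0 mul1r [X in _ + X]big1 ?addr0.
  apply: eq_bigr => i _; rewrite perm1 big1 ?mulr1 // => j _.
  by rewrite perm1 F0 mxE eqxx.
move=> s s1; rewrite big1 ?mulr0 // => i _.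
(* A permutation other than the identity moves some index besides [i]: if it fixed all of those, it
   would fix [i] too. The factor at that index is an off-diagonal entry of the identity. *)
have [j /andP[ji sj]] : exists j : 'I_n, (j != i) && (s j != j).
  apply: contrapT => hn; move/negP: s1; apply; apply/eqP/permP => k.
  rewrite perm1; have fixk l : l != i -> s l = l.
    move=> li; apply/eqP; apply: contrapT => /negP sl.
    by apply: hn; exists l; rewrite li.
  have [->|/fixk //] := eqVneq k i.
  have [//|si] := eqVneq (s i) i.
  by have := fixk _ si => /perm_inj.
by rewrite (bigD1 j) //= F0 mxE eq_sym (negbTE sj) mul0r mulr0.
Qed.

Lemma is_derive_expRM (c s : R) :
  is_derive s 1 (fun u => expR (c * u)) (c * expR (c * s)).
Proof.
rewrite mulrC; apply: (@is_derive1_comp _ expR (fun v => c * v)).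
by have := is_deriveZ c (is_derive_id s 1); rewrite [_ *: 1]mulr1; exact.
Qed.

Lemma is_derive_expR_unique (g : R -> R) (c : R) :
  (forall s : R, is_derive s 1 g (c * g s)) -> forall s, g s = g 0 * expR (c * s).
Proof.
move=> gd s; have kd (u : R) : is_derive u 1 (fun v => g v * expR (- c * v)) 0.
  have := is_deriveM1 (gd u) (is_derive_expRM (- c) u).
  by move/is_derive_eq; apply; ring.
have := is_derive_0_is_cst s 0 kd; rewrite mulr0 expR0 mulr1 => <-.
by rewrite mulNr expRN divfK // gt_eqF // expR_gt0.
Qed.

(** Multiplicativity, g(v) = g(u) g(v - u), carries the derivative tr A at 0 to every point, so g
    solves g' = (tr A) g. *)
Lemma det_expmx n (A : 'M[R]_n) s : \det (expmx (s *: A)) = expR (s * \tr A).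
Proof.
pose g u := \det (expmx (u *: A)).
have g0 : is_derive (0 : R) 1 g (\tr A).
  have := is_derive_det1 (mxderive_expmx A); rewrite scale0r expmx0 mulmx1; exact.
have gd (u : R) : is_derive u 1 g (\tr A * g u).
  rewrite (_ : g = fun v => g u * (g \o (fun w => w - u)) v); last first.
    by apply/funext => v; rewrite /g /= -det_mulmx -expmxZD addrC subrK.
  have sh : is_derive u 1 (fun w : R => w - u) 1.
    by have := is_deriveB (is_derive_id u 1) (is_derive_cst u u 1); rewrite subr0; exact.
  have g0u : is_derive (u - u) 1 g (\tr A) by rewrite subrr.
  have := is_deriveM1 (is_derive_cst (g u) u 1) (@is_derive1_comp _ g (fun w => w - u) _ _ _ g0u sh).
  rewrite /= subrr; move/is_derive_eq; apply.
  by rewrite mul0r add0r mulr1 /g scale0r expmx0 det1 mulr1 mulrC.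
have := is_derive_expR_unique gd s.
by rewrite {2}/g scale0r expmx0 det1 mul1r mulrC.
Qed.

End MatrixCalculus.

(** * Monotonicity and the fundamental theorem of calculus for real functions *)

Section RealDerivative.
Context {R : realType}.

Lemma is_derive_continuous (f f' : R -> R) :
  (forall x : R, is_derive x 1 f (f' x)) -> continuous f.
Proof.
move=> fd x; apply/differentiable_continuous/derivable1_diffP.
by have [? _] := fd x.
Qed.

Lemma is_derive_ge0_le (f f' : R -> R) (a b : R) :
  (forall x : R, is_derive x 1 f (f' x)) ->
  (forall x, a < x < b -> 0 <= f' x) -> a <= b -> f a <= f b.
Proof.
move=> fd f'0 ab; apply: (@ger0_derive1_ndecr _ f a b) => //.
- move=> x; rewrite in_itv => /f'0; rewrite derive1E.
  by have [_ ->] := fd x.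
- by apply: continuous_subspaceT; exact: is_derive_continuous fd.
Qed.

Lemma is_derive_zero_on (f f' : R -> R) (a b : R) :
  (forall x : R, is_derive x 1 f (f' x)) ->
  (forall x, a < x < b -> f x = 0) -> forall x, a < x < b -> f' x = 0.
Proof.
move=> fd f0 x xab.
have n : \forall y \near x, f y = cst 0 y.
  have : \forall y \near x, y \in `]a, b[ by apply: near_in_itvoo; rewrite in_itv.
  by apply: filterS => y; rewrite in_itv => /f0.
have [_ <-] := fd x; rewrite (near_eq_derive _ n).
by have [_ ->] := is_derive_cst (0 : R) x 1.
Qed.

Lemma Rintegral_FTC2 (f F f' : R -> R) (t : R) : 0 < t ->
  (forall x : R, is_derive x 1 F (f x)) -> (forall x : R, is_derive x 1 f (f' x)) ->
  F 0 = 0 -> \int[lebesgue_measure]_(s in `[0, t]) f s = F t.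
Proof.
move=> t0 Fd fd F0; have Fc := is_derive_continuous Fd.
rewrite /Rintegral (@continuous_FTC2 _ f F) //=; first by rewrite F0 subr0.
- by apply: continuous_subspaceT; exact: is_derive_continuous fd.
- split => [x _||]; first by have [? _] := Fd x.
  + by apply: cvg_at_right_filter; exact: Fc.
  + by apply: cvg_at_left_filter; exact: Fc.
- by move=> x _; rewrite derive1E; have [_ ->] := Fd x.
Qed.

End RealDerivative.

(** * The Gramian in closed form: symmetry, time reversal, rescaling, positivity *)

Section GramianPrimitive.
Context {R : realType} {n : nat}.
Implicit Types (Q B : 'M[R]_n) (x y : 'cV[R]_n).

Definition integrand Q B (s : R) : 'M[R]_n :=
  expmx (s *: B) *m Q *m expmx (s *: B^T).

(* The upper right block of exp(s * vanloan_mx Q B) is e^(-sB) times the integral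
   of e^(uB) Q e^(uB^T) over [0, s] (Van Loan).  This closed form gives both the
   s-derivative of the Gramian and its continuity in B without differentiating
   or estimating integrals. *)
Definition vanloan_mx Q B : 'M[R]_(n + n) := block_mx (- B) Q 0 B^T.

(** It agrees with [gramian] at positive times ([gramianE]) and is differentiable on the whole line;
    [gramian_primitive_opp] evaluates it at negative times. *)
Definition gramian_primitive Q B (s : R) : 'M[R]_n :=
  expmx (s *: B) *m
  (row_mx 1%:M 0 *m expmx (s *: vanloan_mx Q B) *m col_mx 0 1%:M).

Lemma integrand_mxderive Q B : is_mxderive (integrand Q B)
  (fun s => B *m integrand Q B s + integrand Q B s *m B^T).
Proof.
have := mxderiveM (mxderiveMr Q (mxderive_expmx B)) (mxderive_expmx B^T).
move=> h; apply: mxderive_eq h _ => s.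
by rewrite /integrand (expmxZ_comm B^T) !mulmxA.
Qed.

(** The corner [- B] of the block matrix cancels the derivative of the prefactor e^(sB). What
    remains is e^(sB) Q times the lower right block, which is e^(sB^T) by [low]. *)
Lemma gramian_primitive_mxderive Q B :
  is_mxderive (gramian_primitive Q B) (integrand Q B).
Proof.
have low s : row_mx 0 1%:M *m expmx (s *: vanloan_mx Q B) =
    expmx (s *: B^T) *m row_mx 0 1%:M.
  apply: expmx_intertwine; rewrite -scalemxAr -scalemxAl; congr (_ *: _).
  by rewrite mul_row_block !mul0mx mulmx0 !mul1mx !add0r mul_mx_row mulmx0 mulmx1.
have up : row_mx 1%:M 0 *m vanloan_mx Q B =
    - B *m row_mx 1%:M 0 + Q *m row_mx 0 1%:M.
  rewrite mul_row_block !mul0mx !mul1mx !addr0 !mul_mx_row !mulmx0 !mulmx1.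
  by rewrite add_row_mx addr0 add0r.
have := mxderiveM (mxderive_expmx B) (mxderiveMr (col_mx 0 1%:M)
  (mxderiveMl (row_mx 1%:M 0) (mxderive_expmx (vanloan_mx Q B)))).
move=> h; apply: mxderive_eq h _ => s.
rewrite /= (mulmxA (row_mx _ _)) up !mulmxDl !mulmxDr.
rewrite -(mulmxA Q) low !mulNmx !mulmxN -!mulmxA mul_row_col mul0mx add0r mulmx1.
rewrite !mulmxA mulmx1 expmxZ_comm addrA.
by rewrite /integrand -!mulmxA subrr add0r.
Qed.

Lemma gramian_primitive0 Q B : gramian_primitive Q B 0 = 0.
Proof.
rewrite /gramian_primitive !scale0r !expmx0 mulmx1 mul_row_col.
by rewrite mulmx0 mul0mx addr0 mulmx0.
Qed.

Lemma gramianE Q B t : 0 < t -> gramian Q B t = gramian_primitive Q B t.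
Proof.
move=> t0; apply/matrixP => i j; rewrite mxE.
have := Rintegral_FTC2 t0 (fun s => gramian_primitive_mxderive Q B s i j)
  (fun s => integrand_mxderive Q B s i j).
by apply; rewrite gramian_primitive0 mxE.
Qed.

Lemma integrand_sym Q B s : Q^T = Q -> (integrand Q B s)^T = integrand Q B s.
Proof.
by move=> Qs; rewrite /integrand !trmx_mul !expmx_tr Qs !linearZ /= trmxK mulmxA.
Qed.

Lemma gramian_primitive_sym Q B s : Q^T = Q ->
  (gramian_primitive Q B s)^T = gramian_primitive Q B s.
Proof.
move=> Qs; apply: (@mxderive_unique _ _ _ (fun u => (gramian_primitive Q B u)^T)
  (gramian_primitive Q B) (integrand Q B)).
- apply: mxderive_eq (mxderive_tr (gramian_primitive_mxderive Q B)) _ => u.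
  exact: integrand_sym.
- exact: gramian_primitive_mxderive.
- by rewrite gramian_primitive0 trmx0.
Qed.

Lemma integrandD Q B s t : integrand Q B (s + t) =
  expmx (s *: B) *m integrand Q B t *m expmx (s *: B^T).
Proof.
by rewrite /integrand expmxZD addrC expmxZD !mulmxA.
Qed.

Lemma gramian_primitive_opp Q B t :
  gramian_primitive Q (- B) t =
  expmx ((- t) *: B) *m gramian_primitive Q B t *m expmx ((- t) *: B^T).
Proof.
have dF := gramian_primitive_mxderive Q B.
(* Substitution u -> -u in the integral. *)
have opp : gramian_primitive Q (- B) =1
           (fun u => (-1) *: gramian_primitive Q B (-1 * u + 0)).
  apply: (mxderive_unique (gramian_primitive_mxderive Q (- B))).
    apply: mxderive_eq (mxderiveZ (-1) (mxderive_affine (-1) 0 dF)) _ => u.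
    rewrite scalerA mulN1r opprK scale1r addr0 mulN1r /integrand.
    have -> : (- B)^T = - B^T by rewrite linearN.
    by rewrite !scalerN !scaleNr.
  by rewrite mulr0 addr0 !gramian_primitive0 scaler0.
(* Translation of the integration variable by [- t]; at [u = t] the first term on the left vanishes
   and the second is the right side of [opp]. *)
have shift : (fun u => gramian_primitive Q B (1 * u + (- t)) +
                       (-1) *: gramian_primitive Q B (- t)) =1
  (fun u => expmx ((- t) *: B) *m gramian_primitive Q B u *m expmx ((- t) *: B^T)).
  apply: (@mxderive_unique _ _ _ _ _ (fun u => integrand Q B (- t + u))).
  - have h := mxderiveD (mxderive_affine 1 (- t) dF)
                        (mxderive_cst ((-1) *: gramian_primitive Q B (- t))).
    by apply: mxderive_eq h _ => u; rewrite scale1r addr0 mul1r addrC.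
  - apply: mxderive_eq (mxderiveMr _ (mxderiveMl _ dF)) _ => u.
    by rewrite integrandD.
  - by rewrite mulr0 add0r scaleN1r subrr gramian_primitive0 mulmx0 mul0mx.
rewrite -shift mul1r subrr gramian_primitive0 add0r.
by rewrite opp mulN1r addr0.
Qed.

(** Substitution s = t u in the integral, where [D] carries e^(uA) to e^(tuB). *)
Lemma gramian_primitive_rescale Q A B (D : 'M[R]_n) t :
  D *m A = (t *: B) *m D -> D *m Q *m D^T = Q ->
  gramian_primitive Q B t = t *: (D *m gramian_primitive Q A 1 *m D^T).
Proof.
move=> DA DQ.
have : (fun u => gramian_primitive Q B (t * u + 0)) =1
       (fun u => t *: (D *m gramian_primitive Q A u *m D^T)).
  apply: (@mxderive_unique _ _ _ _ _ (fun u => t *: integrand Q B (t * u))).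
  - apply: mxderive_eq (mxderive_affine t 0 (gramian_primitive_mxderive Q B)) _.
    by move=> u; rewrite addr0.
  - apply: mxderive_eq (mxderiveZ t (mxderiveMr D^T (mxderiveMl D
      (gramian_primitive_mxderive Q A)))) _ => u.
    have DE : D *m expmx (u *: A) = expmx ((t * u) *: B) *m D.
      apply: expmx_intertwine; rewrite -scalemxAr DA -!scalemxAl.
      by rewrite scalerA mulrC.
    have DET : expmx (u *: A^T) *m D^T = D^T *m expmx ((t * u) *: B^T).
      have := congr1 trmx DE; rewrite !trmx_mul !expmx_tr.
      by rewrite !linearZ.
    rewrite /integrand !mulmxA DE -!mulmxA DET (mulmxA D) (mulmxA (D *m Q)) DQ.
    by rewrite mulmxA.
  - by rewrite mulr0 addr0 !gramian_primitive0 mulmx0 mul0mx scaler0.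
by move=> /(_ 1); rewrite mulr1 addr0.
Qed.

Definition qform (A : 'M[R]_n) x : R := (x^T *m A *m x) 0 0.

Lemma qform_integrand Q B s x :
  qform (integrand Q B s) x = qform Q (expmx (s *: B^T) *m x).
Proof.
by rewrite /qform /integrand trmx_mul expmx_tr linearZ /= trmxK !mulmxA.
Qed.

Lemma qform_gramian_derive Q B x (s : R) :
  is_derive s 1 (fun u => qform (gramian_primitive Q B u) x)
    (qform (integrand Q B s) x).
Proof.
exact: (mxderiveMr x (mxderiveMl x^T (gramian_primitive_mxderive Q B))).
Qed.

Lemma qform_gramian_le Q B x s t : possemidefmx Q -> s <= t ->
  qform (gramian_primitive Q B s) x <= qform (gramian_primitive Q B t) x.
Proof.
move=> Qp; apply: (is_derive_ge0_le (qform_gramian_derive Q B x)) => u _.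
by rewrite qform_integrand; exact: Qp.
Qed.

Lemma dot_eq0 x : (x^T *m x) 0 0 = 0 -> x = 0.
Proof.
rewrite mxE => /eqP; rewrite psumr_eq0 => [/allP h|i _]; last first.
  by rewrite mxE -expr2 sqr_ge0.
apply/matrixP => i j; rewrite ord1 [RHS]mxE; have := h i (mem_index_enum _).
by rewrite /= mxE -expr2 sqrf_eq0 => /eqP.
Qed.

(** Along the line x + l Q x the form is 2 l b + l^2 c with b = |Q x|^2, which is negative for small
    negative [l] unless b = 0. *)
Lemma qform_eq0 Q x : Q^T = Q -> possemidefmx Q -> qform Q x = 0 -> Q *m x = 0.
Proof.
move=> Qs Qp Qx0; pose z := Q *m x; apply: dot_eq0; rewrite -/z.
set b := (z^T *m z) 0 0; pose c := qform Q z.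
have c0 : 0 <= c by exact: Qp.
have xz : x^T *m Q *m z = z^T *m z by rewrite /z trmx_mul Qs.
have zx : z^T *m Q *m x = z^T *m z by rewrite -mulmxA.
have expand l : qform Q (x + l *: z) = 2 * l * b + l ^+ 2 * c.
  have -> : qform Q (x + l *: z) =
      ((x^T + l *: z^T) *m Q *m (x + l *: z)) 0 0.
    by congr ((_ *m _ *m _) 0 0); rewrite linearD linearZ.
  rewrite !mulmxDl !mulmxDr -!scalemxAl -!scalemxAr.
  rewrite xz zx /b /c; move: Qx0; rewrite /qform.
  move: (x^T *m Q *m x) (z^T *m z) (z^T *m Q *m z) => X Y Z X0.
  by rewrite !mxE X0; ring.
apply/eqP; apply: contrapT => /negP b0.
(* With l = -b / (c + 1) the value is -(b / (c + 1))^2 (c + 2); the [+ 1] keeps the denominator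
   positive when c = 0. *)
have := Qp (x + (- b / (c + 1)) *: z).
rewrite -[leRHS]/(qform Q _) expand => h.
have c1 : 0 < c + 1 by rewrite ltr_wpDl.
have : 2 * (- b / (c + 1)) * b + (- b / (c + 1)) ^+ 2 * c =
       - (b / (c + 1)) ^+ 2 * (c + 2).
  by field; rewrite gt_eqF.
move: h => /[swap] ->; rewrite mulNr oppr_ge0 leNgt mulr_gt0 //.
  by rewrite exprn_even_gt0 // mulf_neq0 // invr_neq0 // gt_eqF.
by rewrite ltr_wpDl.
Qed.

(** Kalman observability of the pair [Q], [B^T]: the kernel condition in the form used for
    positivity of the Gramian. *)
Definition observable Q B :=
  forall y, (forall m, Q *m (B^T) ^+ m *m y = 0) -> y = 0.

(** If the form vanishes at x at time [t], monotonicity makes it vanish on [0, t], so Q e^(sB^T) x =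
    0 on the open interval. Differentiating repeatedly gives Q (B^T)^m e^(sB^T) x = 0 for all m. *)
Lemma gramian_posdef Q B t : Q^T = Q -> possemidefmx Q -> observable Q B ->
  0 < t -> posdefmx (gramian_primitive Q B t).
Proof.
move=> Qs Qp obs t0 x x0; rewrite -[ltRHS]/(qform _ _).
have F0 : qform (gramian_primitive Q B 0) x = 0.
  by rewrite gramian_primitive0 /qform mulmx0 mul0mx mxE.
rewrite lt_def; apply/andP; split; last first.
  by rewrite -F0 qform_gramian_le // ltW.
apply: contra_neq x0 => Ft0.
have zero s : 0 < s < t -> qform (gramian_primitive Q B s) x = 0.
  move=> /andP[s0 st]; apply: le_anti; apply/andP; split.
    by rewrite -Ft0 qform_gramian_le // ltW.
  by rewrite -F0 qform_gramian_le // ltW.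
have ker m s : 0 < s < t -> Q *m (B^T) ^+ m *m (expmx (s *: B^T) *m x) = 0.
  elim: m s => [|m IH] s sE.
    rewrite expr0 mulmx1; apply: qform_eq0 => //.
    rewrite -qform_integrand.
    exact: (is_derive_zero_on (qform_gramian_derive Q B x) zero).
  have d := mxderiveMl (Q *m B^T ^+ m) (mxderiveMr x (mxderive_expmx B^T)).
  apply/matrixP => i j; rewrite [RHS]mxE.
  have := is_derive_zero_on (fun s => d s i j) _ sE.
  rewrite exprSr -mulmxE !mulmxA; apply => u uE.
  by rewrite IH // mxE.
(* Any interior point would do; the derivatives are known to vanish only on the open interval. *)
have tE : 0 < t / 2 < t by rewrite divr_gt0 // ltr_pdivrMr // ltr_pMr // ltr1n.
have := obs _ (fun m => ker m _ tE).
move=> /(congr1 (mulmx (expmx ((- (t / 2)) *: B^T)))).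
by rewrite mulmxA expmxNK mul1mx mulmx0.
Qed.

End GramianPrimitive.

(** * Schur complements and determinant inequalities for symmetric matrices *)

Section PositiveDefinite.
Context {R : realType}.

Lemma qform_congr m n (A : 'M[R]_n) (P : 'M[R]_(m, n)) (x : 'cV[R]_m) :
  qform (P *m A *m P^T) x = qform A (P^T *m x).
Proof. by rewrite /qform trmx_mul trmxK !mulmxA. Qed.

Lemma qform1 n (x : 'cV[R]_n) : qform 1%:M x = \sum_i x i 0 ^+ 2.
Proof.
rewrite /qform mulmx1 mxE; apply: eq_bigr => i _.
by rewrite mxE expr2.
Qed.

Lemma qform1_ge0 n (x : 'cV[R]_n) : 0 <= qform 1%:M x.
Proof. by rewrite qform1 sumr_ge0 // => i _; exact: sqr_ge0. Qed.

Lemma qform1_col_mx m n (v : 'cV[R]_m) (y : 'cV[R]_n) :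
  qform 1%:M y <= qform 1%:M (col_mx v y).
Proof.
rewrite !qform1 big_split_ord /=.
under [X in _ <= _ + X]eq_bigr do rewrite col_mxEd.
by rewrite lerDr sumr_ge0 // => i _; exact: sqr_ge0.
Qed.

Lemma qform_delta n (A : 'M[R]_n) i j (c : R) :
  qform A (delta_mx i 0 + c *: delta_mx j 0) =
  A i i + c * (A i j + A j i) + c ^+ 2 * A j j.
Proof.
have d k l : (delta_mx k 0 : 'cV_n)^T *m A *m (delta_mx l 0 : 'cV_n) = (A k l)%:M.
  rewrite trmx_delta -rowE -colE.
  by apply/matrixP => a b; rewrite !ord1 !mxE mulr1n.
rewrite /qform (_ : (_ + _)^T = (delta_mx i 0)^T + c *: (delta_mx j 0)^T); last first.
  by rewrite linearD linearZ.
rewrite !mulmxDl !mulmxDr -!scalemxAl -!scalemxAr !d !mxE eqxx !mulr1n.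
ring.
Qed.

Lemma qform_delta1 n (A : 'M[R]_n) i : qform A (delta_mx i 0) = A i i.
Proof.
by have := qform_delta A i i 0; rewrite scale0r addr0 mul0r expr0n mul0r !addr0.
Qed.

(** Schur complement of the top left entry, for symmetric [A]: the transposed lower left column
    stands for the upper right row. *)
Definition schur n (A : 'M[R]_(1 + n)) : 'M[R]_n :=
  drsubmx A - (A 0 0)^-1 *: (dlsubmx A *m (dlsubmx A)^T).

Definition pivot_mx n (A : 'M[R]_(1 + n)) : 'M[R]_(1 + n) :=
  block_mx 1%:M 0 (- (A 0 0)^-1 *: dlsubmx A) 1%:M.

Lemma det_pivot_mx n (A : 'M[R]_(1 + n)) : \det (pivot_mx A) = 1.
Proof. by rewrite det_lblock !det1 mulr1. Qed.

Lemma pivot_mxE n (A : 'M[R]_(1 + n)) : A^T = A -> A 0 0 != 0 ->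
  pivot_mx A *m A *m (pivot_mx A)^T = block_mx (A 0 0)%:M 0 0 (schur A).
Proof.
move=> As a0; set a := A 0 0; set w := dlsubmx A.
have {2}-> : A = block_mx a%:M w^T w (drsubmx A).
  rewrite -{1}(submxK A); congr block_mx.
    by rewrite [ulsubmx A]mx11_scalar !mxE !lshift0.
  by rewrite -[in LHS]As /w trmx_dlsub.
rewrite /pivot_mx -/a -/w mulmx_block !mul1mx !mul0mx !addr0.
rewrite tr_block_mx !trmx1 trmx0 mulmx_block !mulmx1 !mulmx0 !addr0.
rewrite linearZ /= mul_scalar_mx scalerA mulrN mulfV // scaleN1r addNr.
have -> : - a^-1 *: w *m a%:M + w = 0.
  by rewrite mul_mx_scalar scalerA mulrN mulfV // scaleN1r addNr.
rewrite mul0mx add0r; congr block_mx.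
by rewrite /schur -/a -/w addrC -scalemxAl scaleNr.
Qed.

Lemma det_schur n (A : 'M[R]_(1 + n)) : A^T = A -> A 0 0 != 0 ->
  \det A = A 0 0 * \det (schur A).
Proof.
move=> As a0; have := congr1 determinant (pivot_mxE As a0).
rewrite !det_mulmx det_tr det_pivot_mx mul1r mulr1 => ->.
by rewrite det_ublock det_scalar1.
Qed.

Lemma schur_sym n (A : 'M[R]_(1 + n)) : A^T = A -> (schur A)^T = schur A.
Proof.
move=> As; rewrite /schur linearB linearZ /= trmx_mul trmxK trmx_drsub.
by rewrite As.
Qed.

(** Completing the square: [v] is the first coordinate that annihilates the square involving the
    pivot. *)
Lemma qform_schur n (A : 'M[R]_(1 + n)) (y : 'cV[R]_n) : A^T = A -> A 0 0 != 0 ->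
  exists v : 'cV[R]_1, qform (schur A) y = qform A (col_mx v y).
Proof.
move=> As a0; exists (- (A 0 0)^-1 *: (dlsubmx A)^T *m y).
have -> : col_mx (- (A 0 0)^-1 *: (dlsubmx A)^T *m y) y =
          (pivot_mx A)^T *m col_mx 0 y.
  rewrite tr_block_mx mul_block_col !trmx1 trmx0 !mulmx0 !add0r mul1mx.
  by rewrite linearZ.
rewrite -qform_congr pivot_mxE // /qform tr_col_mx mul_row_block !mulmx0 !addr0.
by rewrite mul_row_col trmx0 mul0mx mulmx0 !add0r.
Qed.

Lemma posdef_diag_gt0 n (A : 'M[R]_n) i : posdefmx A -> 0 < A i i.
Proof.
move=> /(_ (delta_mx i 0)); rewrite -[X in 0 < X]/(qform _ _) qform_delta1; apply.
by apply/eqP => /matrixP/(_ i 0); rewrite !mxE !eqxx => /eqP; rewrite oner_eq0.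
Qed.

Lemma schur_posdef n (A : 'M[R]_(1 + n)) : A^T = A -> posdefmx A ->
  posdefmx (schur A).
Proof.
move=> As Ap y y0; rewrite -[ltRHS]/(qform _ _).
have [|v ->] := qform_schur y As; first by rewrite gt_eqF // posdef_diag_gt0.
by apply: Ap; rewrite col_mx_eq0 negb_and y0 orbT.
Qed.

(** Inverse Cholesky factor by induction on the size: eliminate the first column, divide by the
    square root of the pivot, and recurse on the Schur complement. *)
Lemma posdef_congr1 n (A : 'M[R]_n) : A^T = A -> posdefmx A ->
  exists2 L : 'M[R]_n, L \in unitmx & L *m A *m L^T = 1%:M.
Proof.
elim: n A => [|n IH] A As Ap.
  by exists 1%:M; [exact: unitmx1|apply/matrixP => -[]].
have a0 : 0 < A 0 0 by exact: posdef_diag_gt0.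
have [L Lu LS] := IH (@schur n A) (@schur_sym n A As) (@schur_posdef n A As Ap).
pose D : 'M[R]_(1 + n) := block_mx ((Num.sqrt (A 0 0))^-1)%:M 0 0 L.
exists (D *m @pivot_mx n A).
  have dD : \det D = (Num.sqrt (A 0 0))^-1 * \det L.
    by rewrite det_ublock det_scalar1.
  rewrite unitmx_mul !unitmxE (@det_pivot_mx n) unitr1 andbT dD.
  rewrite unitrM -unitmxE Lu andbT unitfE invr_neq0 // gt_eqF //.
  by rewrite sqrtr_gt0.
have DD : D *m block_mx (A 0 0)%:M 0 0 (@schur n A) *m D^T = 1%:M.
  rewrite tr_block_mx !trmx0 !mulmx_block !mul0mx !mulmx0 !addr0 !add0r !mul0mx LS.
  rewrite tr_scalar_mx -!scalar_mxM mulrAC -expr2 exprVn sqr_sqrtr ?ltW //.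
  by rewrite mulVf ?gt_eqF // -scalar_mx_block.
rewrite -DD -(@pivot_mxE n) ?gt_eqF //.
by rewrite trmx_mul !mulmxA.
Qed.

Lemma posdef_det_gt0 n (A : 'M[R]_n) : A^T = A -> posdefmx A -> 0 < \det A.
Proof.
move=> As Ap; have [L Lu LA] := posdef_congr1 As Ap.
have := congr1 determinant LA; rewrite !det_mulmx det_tr det1 mulrAC => h.
have L2 : 0 < \det L * \det L.
  by rewrite -expr2 exprn_even_gt0 //= -unitfE -unitmxE.
by rewrite -(pmulr_rgt0 _ L2) h ltr01.
Qed.

(** Hadamard's inequality: the determinant is the pivot times that of the Schur complement, whose
    diagonal entries are at most those of [A]. *)
Lemma hadamard_det_le n (A : 'M[R]_n) : A^T = A -> posdefmx A ->
  \det A <= \prod_i A i i.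
Proof.
elim: n A => [|n IH] A As Ap; first by rewrite det_mx00 big_ord0.
have a0 : 0 < A 0 0 by exact: posdef_diag_gt0.
have Ss := @schur_sym n A As; have Sp := @schur_posdef n A As Ap.
rewrite (@det_schur n A As) ?gt_eqF // big_ord_recl ler_wpM2l ?(ltW a0) //.
apply: le_trans (IH _ Ss Sp) _; apply: ler_prod => i _.
rewrite ltW ?posdef_diag_gt0 //= !mxE big_ord1 !mxE !rshift1.
by rewrite gerBl // -expr2 mulr_ge0 ?sqr_ge0 // invr_ge0 ltW.
Qed.

Lemma amgm_det n (A : 'M[R]_n) : A^T = A -> posdefmx A ->
  \det A <= (\tr A / n%:R) ^+ n.
Proof.
move=> As Ap; apply: le_trans (hadamard_det_le As Ap) _.
have := @leif_AGM R _ ('I_n) (fun i => A i i).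
rewrite card_ord => h; apply: leif_le; apply: h => i _.
exact: ltW (posdef_diag_gt0 _ Ap).
Qed.

(** The pivot is at least 1, and the Schur complement again dominates the identity, because its form
    at y is that of [A] at some (v, y). *)
Lemma ge1_det_ge1 n (A : 'M[R]_n) : A^T = A ->
  (forall x, qform 1%:M x <= qform A x) -> 1 <= \det A.
Proof.
elim: n A => [|n IH] A As A1; first by rewrite det_mx00.
have a1 : 1 <= A 0 0.
  by have := A1 (delta_mx 0 0); rewrite !qform_delta1 mxE.
have a0 : A 0 0 != 0 by rewrite gt_eqF // (lt_le_trans _ a1).
rewrite (@det_schur n A As a0); apply: mulr_ege1 => //.
apply: IH => [|y]; first exact: (@schur_sym n).
have [v ->] := @qform_schur n A y As a0; apply: le_trans (A1 _).
exact: (@qform1_col_mx 1 n v y).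
Qed.

(** A transposition brings index [i] to the front; the determinant is then [A i i] times that of a
    Schur complement dominating the identity. *)
Lemma ge1_diag_le_det n (A : 'M[R]_n) i : A^T = A ->
  (forall x, qform 1%:M x <= qform A x) -> A i i <= \det A.
Proof.
case: n A i => [A []//|n A i As A1].
pose s := tperm 0 i; pose A' : 'M[R]_n.+1 := \matrix_(k, l) A (s k) (s l).
have A'E : A' = perm_mx s *m A *m (perm_mx s)^T.
  rewrite -mulmxA -row_permE tr_perm_mx -col_permE.
  by apply/matrixP => k l; rewrite !mxE.
have dA : \det A' = \det A.
  rewrite A'E !det_mulmx det_tr mulrAC det_perm.
  by rewrite -expr2 sqrr_sign mul1r.
have As' : A'^T = A' by apply/matrixP => k l; rewrite !mxE -[in LHS]As mxE.
have A1' x : qform 1%:M x <= qform A' x.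
  rewrite A'E qform_congr (le_trans _ (A1 _)) //.
  rewrite -qform_congr mulmx1 tr_perm_mx -perm_mxM mulgV.
  by rewrite perm_mx1.
have a1 : 1 <= A' 0 0.
  by have := A1' (delta_mx 0 0); rewrite !qform_delta1 mxE.
have a0 : A' 0 0 != 0 by rewrite gt_eqF // (lt_le_trans _ a1).
have -> : A i i = A' 0 0 by rewrite mxE tpermL.
rewrite -dA (@det_schur n A' As' a0) ler_peMr // ?(le_trans ler01) //.
apply: ge1_det_ge1 => [|y]; first exact: (@schur_sym n).
have [v ->] := @qform_schur n A' y As' a0; apply: le_trans (A1' _).
exact: (@qform1_col_mx 1 n v y).
Qed.

(** Nonnegativity of the form at e_i + e_j and e_i - e_j bounds each off-diagonal entry by the mean
    of two diagonal ones, hence by the determinant. *)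
Lemma qform_le_det n (A : 'M[R]_n) (u : 'cV[R]_n) : A^T = A ->
  (forall x, qform 1%:M x <= qform A x) ->
  qform A u <= (\sum_i `|u i 0|) ^+ 2 * \det A.
Proof.
move=> As A1; have diag i := ge1_diag_le_det i As A1.
have off i j : `|A i j| <= \det A.
  have Aji : A j i = A i j by rewrite -[in LHS]As mxE.
  have hp := A1 (delta_mx i 0 + 1 *: delta_mx j 0).
  have hm := A1 (delta_mx i 0 + (-1) *: delta_mx j 0).
  have := le_trans (qform1_ge0 _) hp; have := le_trans (qform1_ge0 _) hm.
  rewrite !qform_delta Aji ler_norml; have := diag i; have := diag j.
  by move=> *; apply/andP; split; lra.
rewrite /qform mxE expr2 !mulr_suml.
rewrite [leRHS](_ : _ = \sum_i \sum_j `|u i 0| * `|u j 0| * \det A); last first.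
  apply: eq_bigr => i _; rewrite -mulrA mulr_suml mulr_sumr.
  by apply: eq_bigr => j _; rewrite mulrA.
rewrite (_ : \sum_j _ = \sum_i \sum_j u i 0 * A i j * u j 0); last first.
  rewrite exchange_big; apply: eq_bigr => j _; rewrite !mxE mulr_suml.
  by apply: eq_bigr => i _; rewrite mxE.
apply: ler_sum => i _; apply: ler_sum => j _; rewrite mulrAC.
by rewrite (le_trans (ler_norm _)) // !normrM ler_wpM2l // mulr_ge0.
Qed.

(** A congruence normalises [A] to the identity and [u] to L^(-T) u. The constant is independent of
    [N], so growth of [N] in the single direction [u] forces growth of its determinant. *)
Lemma posdef_dominated_det n (A : 'M[R]_n) : A^T = A -> posdefmx A ->
  forall u : 'cV[R]_n, exists2 c : R, 0 < c & forall N : 'M[R]_n, N^T = N ->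
    (forall x, qform A x <= qform N x) ->
    \det A <= \det N /\ qform N u <= c * \det N.
Proof.
move=> As Ap u; have [L Lu LA] := posdef_congr1 As Ap.
have dL : 0 < \det L ^+ 2 by rewrite exprn_even_gt0 //= -unitfE -unitmxE.
have LT : (invmx L)^T *m L^T = 1%:M by rewrite -trmx_mul mulmxV // trmx1.
have LT' : L^T *m (invmx L)^T = 1%:M by rewrite -trmx_mul mulVmx // trmx1.
exists ((\sum_i `|((invmx L)^T *m u) i 0|) ^+ 2 * \det L ^+ 2 + 1).
  by rewrite ltr_wpDl // mulr_ge0 ?sqr_ge0 ?ltW.
move=> N Ns NA; pose N1 := L *m N *m L^T.
have dN1 : \det N1 = \det L ^+ 2 * \det N.
  by rewrite !det_mulmx det_tr mulrAC -expr2.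
have dA : \det L ^+ 2 * \det A = 1.
  by have := congr1 determinant LA; rewrite !det_mulmx det_tr det1 mulrAC -expr2.
have N1s : N1^T = N1 by rewrite !trmx_mul trmxK Ns mulmxA.
have N1ge x : qform 1%:M x <= qform N1 x by rewrite -LA !qform_congr.
have d1 := ge1_det_ge1 N1s N1ge.
split; first by rewrite -(ler_pM2l dL) dA -dN1.
have := qform_le_det ((invmx L)^T *m u) N1s N1ge.
rewrite qform_congr mulmxA LT' mul1mx dN1 mulrA => h.
rewrite mulrDl mul1r (le_trans h) // lerDl.
by rewrite -(pmulr_rge0 _ dL) -dN1 (le_trans ler01).
Qed.

End PositiveDefinite.

(** * Observability, dilations and homogeneity in block coordinates *)

Section CanonicalBlocks.
Context {R : realType} {nu : nat} {p : 'I_nu.+1 -> nat}.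
Implicit Types Q B : 'M[R]_(\sum_i p i).
Local Notation bl := (@tagnat.sig1 _ p).

Lemma submxcol_mulmx (A : 'M[R]_(\sum_i p i)) (y : 'cV[R]_(\sum_i p i)) i :
  submxcol (A *m y) i = \sum_j submxblock A i j *m submxcol y j.
Proof.
by rewrite -{1}(submxblockK A) -{1}(submxcolK y) mul_mxblock_mxrow mxcolK.
Qed.

Lemma submxblock_sigE (A : 'M[R]_(\sum_i p i)) k l :
  A k l = submxblock A (bl k) (bl l) (tagnat.sig2 k) (tagnat.sig2 l).
Proof. by rewrite mxE !tagnat.sig2K. Qed.

Lemma sum_sig1 (f : 'I_nu.+1 -> nat) :
  (\sum_k f (bl k) = \sum_i p i * f i)%N.
Proof.
have -> : (\sum_i p i * f i = \sum_i \sum_(j < p i) f i)%N.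
  by apply: eq_bigr => i _; rewrite sum_nat_const card_ord.
by rewrite sig_big_dep /= (reindex _ tagnat.sig_bij_on).
Qed.

(** The vectors killed by all Q (B^T)^m are stable under B^T, and block 0 of each is zero since Q_0
    > 0. If blocks 0 to j always vanish, block j of B^T z reduces to B_(j+1)^T z_(j+1), and
    B_(j+1)^T is injective by the rank condition. *)
Lemma canonical_observable Q B : Defs.canonical_form Q B -> observable Q B.
Proof.
move=> c y Sy.
pose S (z : 'cV[R]_(\sum_i p i)) := forall m, Q *m (B^T) ^+ m *m z = 0.
have ST z : S z -> S (B^T *m z).
  by move=> Sz m; rewrite mulmxA -(mulmxA Q) mulmxE -exprSr -mulmxE.
have S0 z : S z -> submxcol z ord0 = 0.
  move=> /(_ 0%N); rewrite expr0 mulmx1 => /(congr1 (fun w => submxcol w ord0)).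
  rewrite submxcol_mulmx submxcol0 big_ord_recl big1 ?addr0 => [h|j _].
    apply/eqP; apply: contrapT => /negP z0.
    have := canon_Q0_posdef c z0; rewrite -mulmxA h mulmx0 mxE.
    by rewrite ltxx.
  by rewrite (canon_Q_eq0 c) ?mul0mx.
suff vanish j z : S z -> forall i : 'I_nu.+1, (i <= j)%N -> submxcol z i = 0.
  rewrite -(submxcolK y); apply/matrixP => k l; rewrite mxE.
  by rewrite (vanish nu y Sy) ?mxE // -ltnS.
elim: j z => [|j IH] z Sz i.
  by rewrite leqn0 => /eqP i0; rewrite (_ : i = ord0) ?S0 //; exact: val_inj.
rewrite leq_eqVlt => /orP[/eqP ij|]; last by rewrite ltnS; exact: IH.
have jn : (j < nu.+1)%N by rewrite (leq_trans _ (ltnW (ltn_ord i))) // ij.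
pose j' : 'I_nu.+1 := Ordinal jn.
have := IH _ (ST _ Sz) j' (leqnn _); rewrite submxcol_mulmx (bigD1 i) //=.
rewrite [X in _ + X]big1 ?addr0 => [h|k ki].
  apply: trmx_inj; rewrite trmx0; apply/eqP.
  have := congr1 trmx h; rewrite trmx_mul tr_submxblock trmxK trmx0 => /eqP.
  rewrite mulmx_free_eq0 // /row_free.
  by rewrite (canon_B_subdiag_rank c).
rewrite -tr_submxblock; case: (ltngtP k i) => [lt|gt|/val_inj e].
- by rewrite (IH z Sz k) ?mulmx0 // -ltnS -ij.
- by rewrite (canon_B_below_eq0 c) ?trmx0 ?mul0mx //= -ij.
- by rewrite e eqxx in ki.
Qed.

(* t D^-1 B D for D = dilation t, written so as to make sense at t = 0, where it
   is the subdiagonal part of B.  The subtraction of exponents truncates only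
   where the entry of B vanishes. *)
Definition rescaled B (t : R) : 'M[R]_(\sum_i p i) :=
  \matrix_(k, l) (t ^+ ((bl l).+1 - bl k) * B k l).

Lemma submxblock_rescaled B t i j :
  submxblock (rescaled B t) i j = t ^+ (j.+1 - i) *: submxblock B i j.
Proof. by apply/matrixP => a b; rewrite !mxE !tagnat.Rank1K. Qed.

Lemma canonical_rescaled Q B t : Defs.canonical_form Q B ->
  Defs.canonical_form Q (rescaled B t).
Proof.
move=> c; split; try by case: c.
- move=> i j ij; rewrite submxblock_rescaled ij subnn expr0 scale1r.
  exact: (canon_B_subdiag_rank c).
- move=> i j ij; rewrite submxblock_rescaled (canon_B_below_eq0 c) //.
  by rewrite scaler0.
Qed.

Definition dilation (t : R) : 'M[R]_(\sum_i p i) :=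
  diag_mx (\row_k t ^+ bl k).

Lemma dilation_rescaled Q B t : Defs.canonical_form Q B ->
  dilation t *m rescaled B t = (t *: B) *m dilation t.
Proof.
move=> c; apply/matrixP => k l; rewrite mul_diag_mx mul_mx_diag !mxE.
(* In the first case the exponent does not truncate, so the powers add up to [(bl l).+1]; in the
   second the entry of [B] is zero. *)
have [kl|lk] := leqP (bl k) (bl l).+1.
  by rewrite mulrA -exprD subnKC // exprS; ring.
have -> : B k l = 0 by rewrite submxblock_sigE (canon_B_below_eq0 c) ?mxE.
by rewrite !(mulr0, mul0r).
Qed.

Lemma dilation_Q Q B t : Defs.canonical_form Q B ->
  dilation t *m Q *m (dilation t)^T = Q.
Proof.
move=> c; apply/matrixP => k l; rewrite tr_diag_mx mul_diag_mx mul_mx_diag !mxE.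
have [e|ne] := eqVneq (bl k, bl l) (ord0, ord0).
  by case: e => -> ->; rewrite /= !expr0 mul1r mulr1.
have -> : Q k l = 0 by rewrite submxblock_sigE (canon_Q_eq0 c) ?mxE.
by rewrite mulr0 mul0r.
Qed.

Lemma det_dilation t : \det (dilation t) = t ^+ (\sum_i p i * i)%N.
Proof.
rewrite det_diag -(sum_sig1 (fun i => i : nat)).
by under eq_bigr do rewrite mxE; rewrite prodrXr.
Qed.

(** The first summand is the power of t from the scalar factor of the rescaled Gramian, the second
    that from the two dilation determinants. *)
Lemma local_homogeneous_dimE :
  local_homogeneous_dim p = ((\sum_i p i) + (\sum_i p i * i) * 2)%N.
Proof.
rewrite /local_homogeneous_dim big_distrl -big_split.
by apply: eq_bigr => i _ /=; ring.
Qed.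

Lemma volume_rescaled Q B t : Defs.canonical_form Q B -> 0 < t ->
  volume Q B t = t ^+ local_homogeneous_dim p *
    \det (gramian_primitive Q (rescaled B t) 1).
Proof.
move=> c t0; rewrite /volume gramianE //.
rewrite (gramian_primitive_rescale (dilation_rescaled t c) (dilation_Q t c)).
rewrite detZ !det_mulmx det_tr det_dilation local_homogeneous_dimE.
by rewrite exprD exprM expr2; ring.
Qed.

Lemma rescaled_subdiagonal B t : B = subdiagonal_part B -> rescaled B t = B.
Proof.
move=> Bs; apply/matrixP => k l; rewrite mxE.
have [kl|kl] := eqVneq (bl k : nat) (bl l).+1.
  by rewrite kl subnn expr0 mul1r.
have -> : B k l = 0 by rewrite Bs mxE (negbTE kl) mxE.
by rewrite mulr0.
Qed.

Lemma mxtrace_subdiagonal B : B = subdiagonal_part B -> \tr B = 0.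
Proof.
move=> Bs; rewrite /mxtrace big1 // => k _.
by rewrite Bs mxE -[_ == _]/(_ == (_).+1) eq_sym gtn_eqF // mxE.
Qed.

(** If [nu] were positive, a row of [Q] in the last block would be zero. *)
Lemma canonical_full_rank Q B : Defs.canonical_form Q B ->
  \rank Q = (\sum_i p i)%N -> nu = 0%N.
Proof.
move=> c Qr; case: (posnP nu) => // nu0.
have := canon_size_gt0 c ord_max => pm.
pose k := tagnat.Rank ord_max (Ordinal pm).
have : row k Q = 0.
  apply/rowP => l; rewrite !mxE submxblock_sigE (canon_Q_eq0 c) ?mxE //.
  rewrite xpair_eqE negb_and tagnat.Rank1K; apply/orP; left.
  by rewrite -val_eqE /= -lt0n.
have Qf : row_free Q by rewrite /row_free Qr.
rewrite rowE => /eqP; rewrite mulmx_free_eq0 // => /eqP/matrixP/(_ 0 k).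
by rewrite !mxE !eqxx => /eqP; rewrite oner_eq0.
Qed.

End CanonicalBlocks.

(** * Continuity of the determinant, the exponential and the Gramian *)

Section MatrixContinuity.
Context {R : realType}.

Definition mxcontinuous m n (F : R -> 'M[R]_(m, n)) :=
  forall i j, continuous (fun t => F t i j).

Lemma mxcontinuous_cst m n (C : 'M[R]_(m, n)) : mxcontinuous (fun=> C).
Proof. by move=> i j t; exact: cvg_cst. Qed.

Lemma mxcontinuousM m n k (F : R -> 'M[R]_(m, n)) (G : R -> 'M[R]_(n, k)) :
  mxcontinuous F -> mxcontinuous G -> mxcontinuous (fun t => F t *m G t).
Proof.
move=> Fc Gc i j; under eq_fun do rewrite mxE; move=> t.
by apply: cvg_sumr => l; apply: cvgM; [exact: Fc|exact: Gc].
Qed.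

Lemma mxcontinuousZ m n (c : R) (F : R -> 'M[R]_(m, n)) :
  mxcontinuous F -> mxcontinuous (fun t => c *: F t).
Proof.
move=> Fc i j; under eq_fun do rewrite mxE; move=> t.
by apply: cvgM; [exact: cvg_cst|exact: Fc].
Qed.

Lemma mxcontinuous_tr m n (F : R -> 'M[R]_(m, n)) :
  mxcontinuous F -> mxcontinuous (fun t => (F t)^T).
Proof.
by move=> Fc i j; under eq_fun do rewrite mxE; exact: Fc.
Qed.

Lemma mxcontinuous_block m1 m2 n1 n2 (A : R -> 'M[R]_(m1, n1))
    (B : R -> 'M[R]_(m1, n2)) (C : R -> 'M[R]_(m2, n1)) (D : R -> 'M[R]_(m2, n2)) :
  mxcontinuous A -> mxcontinuous B -> mxcontinuous C -> mxcontinuous D ->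
  mxcontinuous (fun t => block_mx (A t) (B t) (C t) (D t)).
Proof.
move=> Ac Bc Cc Dc a b; rewrite -[a]splitK -[b]splitK.
case: (fintype.split a) => k; case: (fintype.split b) => l /=.
- by under eq_fun do rewrite block_mxEul; exact: Ac.
- by under eq_fun do rewrite block_mxEur; exact: Bc.
- by under eq_fun do rewrite block_mxEdl; exact: Cc.
- by under eq_fun do rewrite block_mxEdr; exact: Dc.
Qed.

Lemma continuous_det n (F : R -> 'M[R]_n) :
  mxcontinuous F -> continuous (fun t => \det (F t)).
Proof.
move=> Fc t; apply: cvg_sumr => s; apply: cvgM; first exact: cvg_cst.
by apply: cvg_big => [|i _]; [exact: mul_continuous|exact: Fc].
Qed.

Lemma mxcontinuous_expmx n (F : R -> 'M[R]_n) :
  mxcontinuous F -> mxcontinuous (fun t => expmx (F t)).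
Proof.
move=> Fc i j t; have [a a0 Fa] := entries_bounded (F t).
pose K : R := n%:R * expR (n%:R * (a + 1)).
have K0 : 0 <= K by rewrite mulr_ge0 // expR_ge0.
(* The bound 1 on [d] keeps the entries of nearby matrices below [a + 1], so that one Lipschitz
   constant [K] serves them all. *)
apply/cvgrPdist_le => e e0; pose d := Num.min 1 (e / (K + 1)).
have d0 : 0 < d by rewrite lt_min ltr01 divr_gt0 // ltr_wpDl.
have : \forall u \near nbhs t, forall i j, `|F t i j - F u i j| <= d.
  apply: filter_forall => k; apply: filter_forall => l.
  by have /cvgrPdist_le/(_ _ d0) := Fc k l t.
apply: filterS => u ud.
have d1 : d <= 1 by rewrite ge_min lexx.
have Fta k l : `|F t k l| <= a + 1 by rewrite (le_trans (Fa k l)) // lerDl.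
have Fua k l : `|F u k l| <= a + 1.
  have -> : F u k l = F t k l - (F t k l - F u k l) by rewrite subKr.
  by rewrite (le_trans (ler_normB _ _)) // lerD // (le_trans (ud k l)).
rewrite (le_trans (expmx_entry_lipschitz i j Fta Fua ud)) //.
rewrite mulrAC -/K; apply: (@le_trans _ _ (K * (e / (K + 1)))).
  by rewrite ler_wpM2l // ge_min lexx orbT.
by rewrite mulrCA ger_pMr // ler_pdivrMr ?mul1r ?lerDl // ltr_wpDl.
Qed.

Lemma mxcontinuous_gramian n (Q : 'M[R]_n) (F : R -> 'M[R]_n) s :
  mxcontinuous F -> mxcontinuous (fun t => gramian_primitive Q (F t) s).
Proof.
move=> Fc; apply: mxcontinuousM.
  by apply: mxcontinuous_expmx; exact: mxcontinuousZ.
apply: mxcontinuousM; last exact: mxcontinuous_cst.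
apply: mxcontinuousM; first exact: mxcontinuous_cst.
apply: mxcontinuous_expmx; apply: mxcontinuousZ; apply: mxcontinuous_block.
- by under eq_fun do rewrite -scaleN1r; exact: mxcontinuousZ.
- exact: mxcontinuous_cst.
- exact: mxcontinuous_cst.
- exact: mxcontinuous_tr.
Qed.

End MatrixContinuity.

(** * Lower bound on the volume for times at most 1 *)

Section VolumeSmallTime.
Context {R : realType} {nu : nat} {p : 'I_nu.+1 -> nat}.
Implicit Types Q B : 'M[R]_(\sum_i p i).

Lemma mxcontinuous_rescaled B : mxcontinuous (rescaled B).
Proof.
move=> i j; under eq_fun do rewrite mxE; move=> t.
by apply: cvgM; [exact: exprn_continuous|exact: cvg_cst].
Qed.

Lemma volume_small_time Q B : Q^T = Q -> possemidefmx Q ->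
  Defs.canonical_form Q B -> exists2 c : R, 0 < c &
    forall t, 0 < t -> t <= 1 -> c * t ^+ local_homogeneous_dim p <= volume Q B t.
Proof.
move=> Qs Qp c; pose f t := \det (gramian_primitive Q (rescaled B t) 1).
have fc : continuous f.
  apply: continuous_det; apply: mxcontinuous_gramian.
  exact: mxcontinuous_rescaled.
have [|t0 _ tmin] := @EVT_min R f 0 1 ler01.
  exact: continuous_subspaceT.
(* The minimiser may be 0; positivity holds there too, since [canonical_rescaled] covers every
   [t]. *)
exists (f t0) => [|t t_gt0 t_le1].
  apply: posdef_det_gt0; first exact: gramian_primitive_sym.
  apply: gramian_posdef => //; apply: canonical_observable.
  exact: canonical_rescaled.
rewrite (volume_rescaled c t_gt0) [leLHS]mulrC; apply: ler_wpM2l.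
  exact: exprn_ge0 (ltW t_gt0).
by apply: (tmin t); rewrite in_itv /= t_le1 ltW.
Qed.

End VolumeSmallTime.

(* Unification would otherwise unfold these constants down to limits of series. *)
Opaque expmx gramian_primitive expR determinant.

(** * Exponential growth of the volume when the spectrum is not imaginary *)

Section VolumeLargeTime.
Context {R : realType}.

Lemma pow_le_expR (a : R) (D : nat) : 0 < a ->
  exists2 C, 0 < C & forall t, 0 <= t -> t ^+ D <= C * expR (a * t).
Proof.
move=> a0; case: D => [|D].
  exists 1 => // t t0; rewrite expr0 mul1r -expR0 ler_expR.
  by rewrite mulr_ge0 // ltW.
have c0 : 0 < D.+1`!%:R / a ^+ D.+1 by rewrite divr_gt0 ?exprn_gt0 // ltr0n fact_gt0.
exists (D.+1`!%:R / a ^+ D.+1) => // t t0.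
have at0 : 0 <= a * t by rewrite mulr_ge0 // ltW.
have le : (a * t) ^+ D.+1 / D.+1`!%:R <= expR (a * t).
  by apply: le_trans (expR_ge1Dxn D at0); rewrite lerDr.
apply: le_trans (_ : D.+1`!%:R / a ^+ D.+1 * ((a * t) ^+ D.+1 / D.+1`!%:R) <= _).
  rewrite exprMn le_eqVlt; apply/orP; left; apply/eqP; field.
  by rewrite pnatr_eq0 -lt0n fact_gt0 expf_neq0 // gt_eqF.
by apply: ler_wpM2l => //; exact: ltW.
Qed.

Context {n : nat}.
Implicit Types Q B : 'M[R]_n.

Lemma observable_opp Q B : observable Q B -> observable Q (- B).
Proof.
move=> obs y Sy; apply: obs => m; have := Sy m.
have -> : (- B)^T = (-1) *: B^T by rewrite linearN scaleN1r.
rewrite exp_scalemx -scalemxAr -scalemxAl => /eqP.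
by rewrite scaler_eq0 signr_eq0 => /eqP.
Qed.

(** The Gramian at time [t] dominates the one at time 1, which serves as the fixed matrix of
    [posdef_dominated_det]; hence [c] is uniform in [t]. *)
Lemma gramian_large_dominated Q B (u : 'cV[R]_n) : Q^T = Q -> possemidefmx Q ->
  observable Q B -> exists2 c : R, 0 < c & forall t, 1 <= t ->
    \det (gramian_primitive Q B 1) <= \det (gramian_primitive Q B t) /\
    qform (gramian_primitive Q B t) u <= c * \det (gramian_primitive Q B t).
Proof.
move=> Qs Qp obs.
have [c c0 dom] := posdef_dominated_det (gramian_primitive_sym B 1 Qs)
  (gramian_posdef Qs Qp obs ltr01) u.
exists c => [//|t t1].
exact: (dom _ (gramian_primitive_sym B t Qs) (fun x => qform_gramian_le B x Qp t1)).
Qed.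

(** The exponent [D] is left free: exponential growth absorbs any power of t. *)
Definition large_time_bound Q B (D : nat) := exists2 g : R, 0 < g &
  forall t, 1 <= t ->
    g * t ^+ D * expR (t * \tr B) <= \det (gramian_primitive Q B t).

(** The determinant for -B is e^(-2t tr B) times that for B, so multiplying the bound for -B by
    e^(2t tr B) turns its factor e^(-t tr B) into e^(t tr B). *)
Lemma large_time_bound_opp Q B D :
  large_time_bound Q (- B) D -> large_time_bound Q B D.
Proof.
move=> [g g0 gB]; exists g => [//|t t1]; have := gB t t1.
rewrite gramian_primitive_opp !det_mulmx !det_expmx mxtrace_tr.
have -> : \tr (- B) = - \tr B by rewrite linearN.
rewrite mulrN mulNr expRN; move: (\det _) (g * _) => d k h.
have e0 : 0 < expR (t * \tr B) by exact: expR_gt0.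
have := ler_wpM2r (ltW e0) h; rewrite !mulfVK ?gt_eqF // => h1.
by have := ler_wpM2r (ltW e0) h1; rewrite mulrAC mulVf ?gt_eqF // mul1r.
Qed.

Lemma large_time_bound_trace_neg Q B D : Q^T = Q -> possemidefmx Q ->
  observable Q B -> \tr B < 0 -> large_time_bound Q B D.
Proof.
move=> Qs Qp obs tr0; have ntr0 : 0 < - \tr B by rewrite oppr_gt0.
have [C C0 CD] := pow_le_expR D ntr0.
have [c _ dom] := gramian_large_dominated 0 Qs Qp obs.
have d1 := posdef_det_gt0 (gramian_primitive_sym B 1 Qs)
  (gramian_posdef Qs Qp obs ltr01).
exists (\det (gramian_primitive Q B 1) / C); first by rewrite divr_gt0.
move=> t t1; have [dt _] := dom t t1; apply: le_trans dt.
have t0 : 0 <= t by rewrite (le_trans ler01).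
have := CD t t0; rewrite mulNr expRN (mulrC _ t) ler_pdivlMr ?expR_gt0 // => h.
rewrite -mulrA -mulrA ger_pMr // ler_pdivrMl // mulr1 //.
Qed.

(* The hypotheses on x and y say that x + iy is an eigenvector of B^T for the
   eigenvalue a + ib. *)
Lemma large_time_bound_eigen Q B D (x y : 'cV[R]_n) (a b : R) :
  Q^T = Q -> possemidefmx Q -> observable Q B -> \tr B = 0 -> 0 < a ->
  B^T *m x = a *: x - b *: y -> B^T *m y = b *: x + a *: y ->
  (x != 0) || (y != 0) -> large_time_bound Q B D.
Proof.
move=> Qs Qp obs tr0 a0 Bx By xy0.
pose M := integrand Q B; pose F := gramian_primitive Q B.
(* The Hermitian form of the integrand at x + iy. In its derivative the terms in [b] from the two
   parts cancel, leaving g' = 2 a g. *)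
pose g s := qform (M s) x + qform (M s) y.
have dg (s : R) : is_derive s 1 g (2 * a * g s).
  have dq (z : 'cV[R]_n) := mxderiveMr z (mxderiveMl z^T (integrand_mxderive Q B)).
  have := is_deriveD (dq x s 0 0) (dq y s 0 0); move/is_derive_eq; apply.
  have tB z w : z^T *m (B *m M s + M s *m B^T) *m w =
      (B^T *m z)^T *m M s *m w + z^T *m M s *m (B^T *m w).
    by rewrite trmx_mul trmxK mulmxDr mulmxDl !mulmxA.
  rewrite -/M !tB Bx By.
  have tx : (a *: x - b *: y)^T = a *: x^T - b *: y^T.
    by rewrite linearB !linearZ.
  have ty : (b *: x + a *: y)^T = b *: x^T + a *: y^T.
    by rewrite linearD !linearZ.
  rewrite tx ty /g /qform.
  rewrite !(mulmxDl, mulmxDr, mulmxBl, mulmxBr, mulNmx, mulmxN).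
  rewrite -!scalemxAl -!scalemxAr.
  move: (x^T *m M s *m x) (x^T *m M s *m y) (y^T *m M s *m x) (y^T *m M s *m y).
  by move=> X Y Z W; rewrite !mxE; ring.
pose ex c s : R := expR (c * s).
have dex c (s : R) : is_derive s 1 (ex c) (c * ex c s) := is_derive_expRM c s.
have gE s : g s = g 0 * ex (2 * a) s := is_derive_expR_unique dg s.
pose phi s := qform (F s) x + qform (F s) y.
have phiE s : phi s = g 0 / (2 * a) * (ex (2 * a) s - 1).
  have dk (u : R) : is_derive u 1 (fun s => phi s - g 0 / (2 * a) * ex (2 * a) s) 0.
    have dphi : is_derive u 1 phi (g u).
      exact: is_deriveD (qform_gramian_derive Q B x u) (qform_gramian_derive Q B y u).
    have := is_deriveB dphi
      (is_deriveM1 (is_derive_cst (g 0 / (2 * a)) u 1) (dex (2 * a) u)).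
    move/is_derive_eq; apply; rewrite gE mul0r add0r /=.
    by field; rewrite gt_eqF.
  have := is_derive_0_is_cst s 0 dk.
  have -> : phi 0 = 0.
    by rewrite /phi /F gramian_primitive0 /qform !mulmx0 !mul0mx !mxE addr0.
  by rewrite /ex mulr0 expR0 => /eqP; rewrite subr_eq => /eqP ->; ring.
have Fp := gramian_posdef Qs Qp obs ltr01.
have phi1 : 0 < phi 1.
  have ge0 z : 0 <= qform (F 1) z.
    have [->|/Fp/ltW //] := eqVneq z 0; by rewrite /qform mulmx0 mxE.
  case/orP: xy0 => [/Fp h|/Fp h]; first exact: ltr_pwDl.
  exact: ltr_wpDl.
have a2 : 0 < 2 * a by rewrite mulr_gt0.
(* Since [Q] is only semidefinite, positivity of [g 0] is read off from [phi 1 > 0]. *)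
have g0 : 0 < g 0.
  have e1 : 0 < ex (2 * a) 1 - 1 by rewrite subr_gt0 /ex mulr1 expR_gt1.
  by move: phi1; rewrite phiE pmulr_lgt0 // pmulr_lgt0 // invr_gt0.
have d1 := posdef_det_gt0 (gramian_primitive_sym B 1 Qs) Fp.
have [cx cx0 domx] := gramian_large_dominated x Qs Qp obs.
have [cy cy0 domy] := gramian_large_dominated y Qs Qp obs.
have [C C0 CD] := pow_le_expR D a2.
pose k := g 0 / (2 * a).
have k0 : 0 < k by rewrite divr_gt0.
(* The last summand absorbs the constant by which k e^(2at) exceeds [phi t], as det F(t) >= det
   F(1). *)
pose c := (cx + cy + k / \det (F 1)).
have c0 : 0 < c by rewrite addr_gt0 ?addr_gt0 // divr_gt0.
exists (k / (C * c)) => [|t t1]; first exact: divr_gt0 k0 (mulr_gt0 C0 c0).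
rewrite tr0 mulr0 expR0 mulr1.
have [dt qx] := domx t t1; have [_ qy] := domy t t1.
have main : k * ex (2 * a) t <= c * \det (F t).
  have -> : k * ex (2 * a) t = phi t + k by rewrite phiE -/k; ring.
  rewrite /c !mulrDl -/(F t) lerD ?lerD //.
  rewrite mulrAC ler_pdivlMr; last exact: d1.
  exact: (ler_wpM2l (ltW k0) dt).
have tD := CD t (le_trans ler01 t1).
rewrite -[leLHS]mulrA mulrC -(ler_pM2l c0).
apply: le_trans main; rewrite (_ : c * _ = k * (C^-1 * t ^+ D)); last first.
  by field; rewrite !gt_eqF.
by rewrite ler_pM2l // ler_pdivrMl.
Qed.

(** Eigenvectors in [eigenvalue] are row vectors, v B = z v, hence the transpose; [x], [y] and [a],
    [b] are the real and imaginary parts of v and z. *)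
Lemma spectrum_real_pair B : ~ (spectrum B `<=` imaginary_axis) ->
  exists (x y : 'cV[R]_n) (a b : R), [/\ a != 0,
    B^T *m x = a *: x - b *: y, B^T *m y = b *: x + a *: y &
    (x != 0) || (y != 0)].
Proof.
move=> nsub.
have [z [/eigenvalueP[v vB v0] z0]] : exists z, spectrum B z /\ complex.Re z != 0.
  apply: contrapT => hn; apply: nsub => z zB; apply: contrapT => z0.
  apply: hn; exists z; split; first exact: zB.
  by apply/eqP => Rz0; apply: z0; exact: Rz0.
have sumRe (f : 'I_n -> R[i]) : complex.Re (\sum_i f i) = \sum_i complex.Re (f i).
  by apply: (big_morph (@complex.Re R)) => // -[? ?] [? ?].
have sumIm (f : 'I_n -> R[i]) : complex.Im (\sum_i f i) = \sum_i complex.Im (f i).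
  by apply: (big_morph (@complex.Im R)) => // -[? ?] [? ?].
exists (\col_i complex.Re (v 0 i)), (\col_i complex.Im (v 0 i)).
exists (complex.Re z), (complex.Im z).
have ent j : \sum_i v 0 i * real_complex R (B i j) = z * v 0 j.
  have /matrixP/(_ 0 j) := vB; rewrite !mxE => <-.
  by apply: eq_bigr => i _; rewrite !mxE.
split => //.
- apply/matrixP => j k; rewrite !mxE; have := congr1 (@complex.Re R) (ent j).
  rewrite sumRe.
  have -> : complex.Re (z * v 0 j) =
      complex.Re z * complex.Re (v 0 j) - complex.Im z * complex.Im (v 0 j).
    by case: z {vB z0 ent} (v 0 j) => ? ? [].
  move=> <-; apply: eq_bigr => i _; rewrite !mxE.
  by case: (v 0 i) => s t /=; ring.
- apply/matrixP => j k; rewrite !mxE; have := congr1 (@complex.Im R) (ent j).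
  rewrite sumIm.
  have -> : complex.Im (z * v 0 j) =
      complex.Im z * complex.Re (v 0 j) + complex.Re z * complex.Im (v 0 j).
    by case: z {vB z0 ent} (v 0 j) => ? ? [? ?] /=; ring.
  move=> <-; apply: eq_bigr => i _; rewrite !mxE.
  by case: (v 0 i) => s t /=; ring.
- rewrite -negb_and; apply: contra v0 => /andP[/eqP rx /eqP ry].
  apply/eqP/matrixP => k j; rewrite ord1 [RHS]mxE.
  have /matrixP/(_ j 0) := rx; have /matrixP/(_ j 0) := ry; rewrite !mxE.
  by case: (v 0 j) => s t /= -> ->.
Qed.

Lemma large_time_bound_nonimaginary Q B D : Q^T = Q -> possemidefmx Q ->
  observable Q B -> ~ (spectrum B `<=` imaginary_axis) -> large_time_bound Q B D.
Proof.
move=> Qs Qp obs /spectrum_real_pair[x [y [a [b [a0 Bx By xy0]]]]].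
have obs' := observable_opp obs.
have trN : \tr (- B) = - \tr B by rewrite linearN.
case: (ltgtP (\tr B) 0) => tr0.
- exact: large_time_bound_trace_neg.
- apply: large_time_bound_opp; apply: large_time_bound_trace_neg => //.
  by rewrite trN oppr_lt0.
case: (ltgtP a 0) => [alt|agt|ae]; last by rewrite ae eqxx in a0.
- apply: large_time_bound_opp.
  have BN : (- B)^T = - B^T by rewrite linearN.
  (* The same vector is an eigenvector of the transpose of -B, for the opposite eigenvalue. *)
  apply: (@large_time_bound_eigen _ _ _ x y (- a) (- b)) => //.
  + by rewrite trN tr0 oppr0.
  + by rewrite oppr_gt0.
  + by rewrite BN mulNmx Bx opprB !scaleNr opprK addrC.
  + by rewrite BN mulNmx By opprD !scaleNr.
- exact: (@large_time_bound_eigen _ _ _ x y a b).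
Qed.

End VolumeLargeTime.

(** * Explicit lower bound for positive definite Q *)

Section VolumePositiveDefinite.
Context {R : realType} {n : nat}.
Implicit Types Q B : 'M[R]_n.

Lemma posdef_observable Q B : posdefmx Q -> observable Q B.
Proof.
move=> Qp y /(_ 0%N); rewrite expr0 mulmx1 => Qy.
apply: contrapT => /eqP/Qp; rewrite -mulmxA Qy mulmx0 mxE.
by rewrite ltxx.
Qed.

Lemma psd_full_rank_posdef Q : Q^T = Q -> possemidefmx Q -> \rank Q = n ->
  posdefmx Q.
Proof.
move=> Qs Qp Qr x x0; rewrite lt_def; apply/andP; split; last exact: Qp.
apply: contra_neq x0 => /(qform_eq0 Qs Qp) Qx.
have Qf : row_free Q by rewrite /row_free Qr.
apply: trmx_inj; rewrite trmx0; apply/eqP.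
by rewrite -(mulmx_free_eq0 x^T Qf) -{1}Qs -trmx_mul Qx trmx0.
Qed.

Lemma posdef_posdefW Q : posdefmx Q -> possemidefmx Q.
Proof.
move=> Qp x; have [->|/Qp/ltW //] := eqVneq x 0.
by rewrite mulmx0 mxE.
Qed.

Lemma is_derive_mxtrace (F F' : R -> 'M[R]_n) : is_mxderive F F' ->
  forall s : R, is_derive s 1 (fun u => \tr (F u)) (\tr (F' s)).
Proof. by move=> FF' s; apply: is_derive_bigsum => i; exact: FF'. Qed.

Lemma expR_scaled_tangent (r k : R) : 0 <= r -> r * (1 + k) <= r * expR k.
Proof. by move=> r0; apply: ler_wpM2l => //; exact: expR_ge1Dx. Qed.

(* Arithmetic-geometric inequality for the congruent integrand, with the resulting
   e^((2s - c) tr B / n) replaced by its tangent line so that it can be integrated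
   by hand. *)
Lemma trace_congr_integrand_ge Q B (L : 'M[R]_n) (r c s : R) :
  (0 < n)%N -> Q^T = Q -> posdefmx Q -> L \in unitmx -> 0 < r ->
  r ^+ n = \det L ^+ 2 * \det Q * expR (c * \tr B) ->
  r * (1 + (2 * s - c) * \tr B / n%:R) <= \tr (L *m integrand Q B s *m L^T) / n%:R.
Proof.
move=> n0 Qs Qp Lu r0 rn; set N := L *m _ *m L^T.
have n0' : (n%:R : R) != 0 by rewrite pnatr_eq0 -lt0n.
have Np : posdefmx N.
  move=> x x0; rewrite -[ltRHS]/(qform N x) qform_congr qform_integrand.
  apply: Qp; apply: contra_neq x0 => /(congr1 (mulmx (expmx ((- s) *: B^T)))).
  rewrite mulmxA expmxNK mul1mx mulmx0 => /(congr1 (mulmx (invmx L^T))).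
  by rewrite mulKmx ?unitmx_tr // mulmx0.
have Ns : N^T = N by rewrite trmx_mul trmxK trmx_mul integrand_sym // mulmxA.
have dN : \det N = (r * expR ((2 * s - c) * \tr B / n%:R)) ^+ n.
  (* The determinant is det(L)^2 det(Q) e^(2s tr B), which is r^n e^((2s - c) tr B). *)
  rewrite exprMn rn -expRM_natl (mulrC n%:R) divfK //.
  rewrite !det_mulmx !det_expmx det_tr mxtrace_tr.

  have -> : expR ((2 * s - c) * \tr B) =
      expR (s * \tr B) * expR (s * \tr B) / expR (c * \tr B).
    by rewrite -expRN -!expRD; congr expR; ring.
  by field; rewrite gt_eqF // expR_gt0.
have := amgm_det Ns Np; rewrite dN => h.
apply: le_trans (expR_scaled_tangent _ (ltW r0)) _.
rewrite -(@ler_pXn2r _ n) // nnegrE.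
  by rewrite mulr_ge0 ?expR_ge0 // ltW.
rewrite divr_ge0 // sumr_ge0 // => i _.
exact: ltW (posdef_diag_gt0 _ Np).
Qed.

Lemma posdef_gramian_det_ge Q B t : (0 < n)%N -> Q^T = Q -> posdefmx Q -> 0 < t ->
  \det Q * t ^+ n * expR (t * \tr B) <= \det (gramian_primitive Q B t).
Proof.
move=> n0 Qs Qp t0; pose F := gramian_primitive Q B.
have n0' : (n%:R : R) != 0 by rewrite pnatr_eq0 -lt0n.
have Fs : (F t)^T = F t := gramian_primitive_sym B t Qs.
have Fp : posdefmx (F t) :=
  gramian_posdef Qs (posdef_posdefW Qp) (@posdef_observable Q B Qp) t0.
have [L Lu LF] := posdef_congr1 Fs Fp.
have dL : 0 < \det L ^+ 2 by rewrite exprn_even_gt0 //= -unitfE -unitmxE.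
have dLF : \det L ^+ 2 * \det (F t) = 1.
  by have := congr1 determinant LF; rewrite !det_mulmx det_tr det1 mulrAC -expr2.
pose X := \det L ^+ 2 * \det Q * expR (t * \tr B).
have X0 : 0 < X.
  by rewrite mulr_gt0 ?expR_gt0 // mulr_gt0 // posdef_det_gt0.
pose r := expR (ln X / n%:R).
have r0 : 0 < r := expR_gt0 _.
have rn : r ^+ n = X.
  by rewrite /r -expRM_natl (mulrC n%:R) divfK // lnK.
pose k := \tr B / n%:R.
(* [h] is a primitive of the gap in the trace inequality with [c = t]. This choice makes the
   integral of 2s - t over [0, t] vanish, so that h(t) = 1 - r t. *)
pose h s := \tr (L *m F s *m L^T) * n%:R^-1 - r * (s * (k * s + (1 - t * k))).
pose h' s := \tr (L *m integrand Q B s *m L^T) / n%:R -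
             r * (1 + (2 * s - t) * \tr B / n%:R).
have dh (s : R) : is_derive s 1 h (h' s).
  have dtr := is_derive_mxtrace
    (mxderiveMr L^T (mxderiveMl L (gramian_primitive_mxderive Q B))) s.
  have dpol := is_deriveM1 (is_derive_id s 1) (is_derive_affine k (1 - t * k) s).
  have := is_deriveB (is_deriveM1 dtr (is_derive_cst (n%:R^-1 : R) s 1))
                     (is_deriveM1 (is_derive_cst r s 1) dpol).
  by move/is_derive_eq; apply; rewrite /h' /k /=; ring.
have h0 : h 0 = 0.
  by rewrite /h /F gramian_primitive0 mulmx0 mul0mx mxtrace0 !mul0r mulr0 subr0.
have : h 0 <= h t.
  apply: (is_derive_ge0_le dh) (ltW t0) => s _; rewrite subr_ge0.
  exact: trace_congr_integrand_ge.
rewrite h0 /h LF mxtrace1 mulfV // => ht.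
have rt : r * t <= 1.
  suff <- : r * (t * (k * t + (1 - t * k))) = r * t by rewrite -subr_ge0.
  ring.
(* The n-th power reads X t^n <= 1 = det(L)^2 det F(t), and det(L)^2 cancels. *)
have : (r * t) ^+ n <= 1 by rewrite exprn_ile1 // mulr_ge0 // ltW.
rewrite exprMn rn /X -dLF => le.
rewrite -(ler_pM2l dL) -/F; apply: le_trans le.
by rewrite le_eqVlt; apply/orP; left; apply/eqP; ring.
Qed.

End VolumePositiveDefinite.

Theorem theorem1p3 (R : realType) (nu : nat) (p : 'I_nu.+1 -> nat)
    (Q B : 'M[R]_(\sum_i p i))
    (hQB : standing_assumptions Q B)
    (hcase :
      [\/ ~ (spectrum B `<=` imaginary_axis),
          spectrum B `<=` imaginary_axis /\ \rank Q = (\sum_i p i)%N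
        | nilpotentmx B /\ B = subdiagonal_part B]) :
  exists gamma : R, 0 < gamma /\
    forall t : R, 0 < t ->
      gamma * t ^+ local_homogeneous_dim p * expR (t * \tr B) <= volume Q B t.
Proof.
case: hQB => n2 Qs Qp _ c; have obs := canonical_observable c.
have F1 := gramian_posdef Qs Qp obs ltr01.
have d1 := posdef_det_gt0 (gramian_primitive_sym B 1 Qs) F1.
case: hcase => [nim | [_ Qr] | [_ Bs]].
- have [c1 c1_gt0 small] := volume_small_time Qs Qp c.
  have [g g0 large] :=
    large_time_bound_nonimaginary (local_homogeneous_dim p) Qs Qp obs nim.
  have e0 : 0 < expR `|\tr B| by exact: expR_gt0.
  have m0 : 0 < Num.min (c1 / expR `|\tr B|) g.
    by rewrite lt_min g0 andbT; exact: divr_gt0.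
  (* For t <= 1 the factor e^(t tr B) is at most e^|tr B|, which the division compensates; [g]
     serves for t > 1. *)
  exists (Num.min (c1 / expR `|\tr B|) g); split=> [//|t t0].
  have tD : 0 <= t ^+ local_homogeneous_dim p by rewrite exprn_ge0 // ltW.
  have et : 0 <= expR (t * \tr B) by exact: expR_ge0.
  have [t1|t1] := leP t 1.
    apply: le_trans (small t t0 t1) => {small large}.
    apply: (@le_trans _ _ (c1 / expR `|\tr B| * t ^+ local_homogeneous_dim p *
                           expR `|\tr B|)); last first.
      by rewrite mulrAC divfK // gt_eqF.
    apply: ler_pM => //; first exact: mulr_ge0 (ltW m0) tD.
      by apply: ler_wpM2r => //; rewrite ge_min lexx.
    rewrite ler_expR (le_trans (ler_norm _)) // normrM gtr0_norm //.
    exact: ler_piMl.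
  rewrite /volume (gramianE Q B t0); apply: le_trans (large t (ltW t1)).
  apply: (ler_wpM2r et); apply: (ler_wpM2r tD).
  by rewrite ge_min lexx orbT.
- have nu0 := canonical_full_rank c Qr.
  (* The block sizes and matrices depend on [nu], so they are generalised before [nu] is replaced by
     0; with a single block D = n. *)
  move: p Q B n2 Qs Qp c obs F1 d1 Qr; subst nu.
  move=> p Q B n2 Qs Qp c obs F1 d1 Qr.
  have Qpd := psd_full_rank_posdef Qs Qp Qr.
  exists (\det Q); split=> [|t t0]; first exact: posdef_det_gt0.
  rewrite /volume (gramianE Q B t0) local_homogeneous_dimE.
  rewrite [X in (_ + X * 2)%N]big_ord1 muln0 addn0.
  by apply: posdef_gramian_det_ge => //; exact: leq_trans n2.
- exists (\det (gramian_primitive Q B 1)); split=> [//|t t0].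
  rewrite (volume_rescaled c t0) (rescaled_subdiagonal t Bs).
  by rewrite (mxtrace_subdiagonal Bs) mulr0 expR0 mulr1 mulrC.
Qed.
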